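(* Let $d$ be a positive integer and let $\mathcal{F}:\mathcal{P}(\mathbb{S}^{d-1})\to\mathbb{R}^{d\times d}$ be such that there is a constant $L_{\mathcal{F}}\ge 0$ with $\|\mathcal{F}[\varrho]-\mathcal{F}[\widetilde\varrho]\|_{\mathrm{op}}\le L_{\mathcal{F}}W_1(\varrho,\widetilde\varrho)$ for all $\varrho,\widetilde\varrho\in\mathcal{P}(\mathbb{S}^{d-1})$, and such that $\mathrm{tr}(\mathcal{F}[\varrho])=0$ for all $\varrho\in\mathcal{P}(\mathbb{S}^{d-1})$. Let $\rho(t)$ be the unique weak solution of $$\partial_t\rho+\operatorname{div}_{\mathbb{S}^{d-1}}(b(\cdot,\rho)\rho)=0,\qquad \rho(0)=\rho_0\in\mathcal{P}(\mathbb{S}^{d-1}),\qquad b(x,\varrho):=(I_d-xx^{\top})\mathcal{F}[\varrho]x.$$ Then $\rho(t)$ admits the representation $$\rho(t)=(\Phi_{G(t)})_{\sharp}\rho_0,\qquad t\ge0,$$ where $G:[0,\infty)\to\mathrm{SL}^{\pm}(d,\mathbb{R})$ solves the closed matrix-valued equation $$\dot G(t)=\mathcal{F}\left[(\Phi_{G(t)})_{\sharp}\rho_0\right]G(t),\qquad G(0)=I_d.$$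
   Context: $\mathbb{S}^{d-1}$ is the unit sphere in $\mathbb{R}^d$ with the Euclidean norm $\|\cdot\|$; $\|\cdot\|_{\mathrm{op}}$ is the matrix operator norm; $\mathcal{P}(\mathbb{S}^{d-1})$ is the set of (Borel) probability measures on $\mathbb{S}^{d-1}$, equipped with the Wasserstein-1 distance $W_1$ induced by the Euclidean distance. $h_\sharp\mu$ is the pushforward of $\mu$ under $h$. For an invertible matrix $G\in\mathbb{R}^{d\times d}$, the normalized linear transformation is $\Phi_G:\mathbb{S}^{d-1}\to\mathbb{S}^{d-1}$, $\Phi_G(x):=Gx/\|Gx\|$. $\mathrm{SL}^{\pm}(d,\mathbb{R}):=\{G\in\mathbb{R}^{d\times d}:|\det G|=1\}$. Weak solution: a curve $\rho\in C([0,\infty);\mathcal{P}(\mathbb{S}^{d-1}))$ (continuous for $W_1$) with $\rho(0)=\rho_0$ such that, for every $\varphi\in C^1(\mathbb{S}^{d-1})$ and every $t\ge0$, $$\int\varphi(x)\,d\rho(t,x)-\int\varphi(x)\,d\rho_0(x)=\int_0^t\int\nabla_{\mathbb{S}^{d-1}}\varphi(x)^{\top}b(x,\rho(s))\,d\rho(s,x)\,ds,$$ where integrals in $x$ are over $\mathbb{S}^{d-1}$ and $\nabla_{\mathbb{S}^{d-1}}$ is the spherical gradient viewed as a tangent vector in $\mathbb{R}^d$. Under the Lipschitz assumption on $\mathcal{F}$, a weak solution exists and is unique for every $\rho_0$. *)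

(* Defs.v *)
From HB Require Import structures.
From mathcomp Require Import all_boot all_order all_algebra.
From mathcomp Require Import all_classical all_reals all_analysis.

Set Implicit Arguments.
Unset Strict Implicit.
Unset Printing Implicit Defensive.

Import Order.TTheory GRing.Theory Num.Theory.
Import numFieldNormedType.Exports.

Local Open Scope classical_set_scope.
Local Open Scope ring_scope.

(* The ambient space is 'cV[R]_n.+1, so the dimension is d = n.+1 >= 1.  The
   library norm `|x| on matrices is the sup norm; [enorm] is the Euclidean one
   (both induce the same topology). *)
Definition enorm (R : realType) (n : nat) (x : 'cV[R]_n) : R :=
  Num.sqrt (\sum_i x i 0 ^+ 2).

Definition unit_sphere (R : realType) (n : nat) : set 'cV[R]_n.+1 :=
  [set x | enorm x = 1].
Arguments unit_sphere : clear implicits.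

Definition opnorm (R : realType) (n : nat) (A : 'M[R]_n.+1) : R :=
  sup [set enorm (A *m x) | x in unit_sphere R n].

Lemma enorm_ge0 (R : realType) (n : nat) (x : 'cV[R]_n) : 0 <= enorm x.
Proof. exact: sqrtr_ge0. Qed.

Lemma enormZ (R : realType) (n : nat) (a : R) (x : 'cV[R]_n) :
  enorm (a *: x) = `|a| * enorm x.
Proof.
rewrite /enorm -sqrtr_sqr -sqrtrM ?sqr_ge0// mulr_sumr.
by congr Num.sqrt; apply: eq_bigr => i _; rewrite mxE exprMn.
Qed.

Lemma enorm_eq0 (R : realType) (n : nat) (x : 'cV[R]_n) :
  (enorm x == 0) = (x == 0).
Proof.
rewrite /enorm sqrtr_eq0 -[_ <= 0]orbF.
have s0 : 0 <= \sum_i x i 0 ^+ 2 by apply: sumr_ge0 => i _; exact: sqr_ge0.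
rewrite orbF; apply/idP/eqP => [le0|->]; last first.
  by rewrite big1// => i _; rewrite mxE expr0n.
have /eqP : \sum_i x i 0 ^+ 2 = 0 by apply/eqP; rewrite eq_le le0 s0.
rewrite psumr_eq0 => [/allP x0|i _]; last exact: sqr_ge0.
apply/colP => i; rewrite mxE; apply/eqP; rewrite -sqrf_eq0.
by apply: x0; rewrite mem_index_enum.
Qed.

Lemma sum_continuous (R : realType) (T : topologicalType)
    (V : normedModType R) (I : Type) (r : seq I) (f : I -> T -> V) :
  (forall i, continuous (f i)) -> continuous (fun x => \sum_(i <- r) f i x).
Proof.
move=> cf; elim: r => [|i r IH] x.
  by under eq_fun do rewrite big_nil; exact: cst_continuous.
under eq_fun do rewrite big_cons.
by apply: continuousD; [exact: cf | exact: IH].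
Qed.

Lemma enorm_continuous (R : realType) (n : nat) : continuous (@enorm R n).
Proof.
move=> x; apply: (@continuous_comp _ _ _
  (fun x : 'cV[R]_n => \sum_i x i 0 ^+ 2) Num.sqrt); last exact: sqrt_continuous.
apply: sum_continuous => i {}x.
apply: (@continuous_comp _ _ _ (fun x : 'cV[R]_n => x i 0) (fun a => a ^+ 2)).
  exact: coord_continuous.
exact: exprn_continuous.
Qed.

Lemma mulmx_col_continuous (R : realType) (n : nat) (G : 'M[R]_n) :
  continuous (fun x : 'cV[R]_n => G *m x).
Proof.
have -> : (fun x : 'cV[R]_n => G *m x) = (fun x => \sum_j x j 0 *: col j G).
  apply/funext => x; apply/colP => i; rewrite !mxE summxE.
  by apply: eq_bigr => j _; rewrite !mxE mulrC.
apply: sum_continuous => j x; apply: continuousZr_tmp.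
exact: coord_continuous.
Qed.

Definition sphere (R : realType) (n : nat) : Type := unit_sphere R n.

HB.instance Definition _ (R : realType) (n : nat) :=
  SubChoice.copy (sphere R n) (set_type (unit_sphere R n)).
HB.instance Definition _ (R : realType) (n : nat) :=
  Topological.copy (sphere R n) (set_type (unit_sphere R n)).

Lemma delta_sphere (R : realType) (n : nat) :
  (delta_mx 0 0 : 'cV[R]_n.+1) \in unit_sphere R n.
Proof.
rewrite inE /= /unit_sphere/= /enorm (bigD1 0)//= !mxE !eqxx expr1n big1 ?addr0.
  exact: sqrtr1.
by move=> i /negbTE i0; rewrite mxE i0 expr0n.
Qed.

HB.instance Definition _ (R : realType) (n : nat) :=
  isPointed.Build (sphere R n)
    (exist (fun x => x \in unit_sphere R n) _ (delta_sphere R n)).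

(* Borel sigma-algebra of the subspace topology. *)
HB.instance Definition _ (R : realType) (n : nat) :=
  Measurable.copy (sphere R n) (g_sigma_algebraType (@open (sphere R n))).

(* x / ||x||, with an arbitrary value at x = 0. *)
Definition normalize (R : realType) (n : nat) (x : 'cV[R]_n.+1) : sphere R n :=
  insubd (point : sphere R n) ((enorm x)^-1 *: x).

Definition Phi (R : realType) (n : nat) (G : 'M[R]_n.+1) (x : sphere R n) :
  sphere R n := normalize (G *m val x).

Lemma val_normalize (R : realType) (n : nat) (x : 'cV[R]_n.+1) :
  x != 0 -> val (normalize x) = (enorm x)^-1 *: x.
Proof.
move=> x0; rewrite val_insubd ifT// inE /= /unit_sphere/=.
by rewrite enormZ ger0_norm ?invr_ge0 ?enorm_ge0// mulVf// enorm_eq0.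
Qed.


Lemma normalize0 (R : realType) (n : nat) :
  normalize (0 : 'cV[R]_n.+1) = point.
Proof.
rewrite /normalize scaler0 /insubd insubF//; apply/negP; rewrite inE /=.
rewrite /unit_sphere/=.
have /eqP -> : enorm (0 : 'cV[R]_n.+1) == 0 by rewrite enorm_eq0.
by move/eqP; rewrite eq_sym oner_eq0.
Qed.

Lemma val_sphere_continuous (R : realType) (n : nat) :
  continuous (val : sphere R n -> 'cV[R]_n.+1).
Proof. exact: initial_continuous. Qed.

Lemma open_measurable_sphere (R : realType) (n : nat) (U : set (sphere R n)) :
  open U -> measurable U.
Proof. by move=> oU; apply: sub_sigma_algebra. Qed.

Lemma measurable_Phi (R : realType) (n : nat) (G : 'M[R]_n.+1) :
  measurable_fun [set: sphere R n] (Phi G).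
Proof.
apply: (@measurability _ _ _ _ _ _ (@open (sphere R n))) => //.
move=> _ [U [B oB <-] <-]; rewrite setTI.
pose g (x : sphere R n) : 'cV[R]_n.+1 := G *m val x.
have cg : continuous g.
  move=> x.
  exact: (continuous_comp (@val_sphere_continuous R n x)
           (@mulmx_col_continuous R n.+1 G (val x))).
pose D := [set v : 'cV[R]_n.+1 | enorm v != 0].
have oD : open D.
  apply: (@open_comp _ _ (@enorm R n.+1) [set x | x != 0]) => [v _|].
    exact: enorm_continuous.
  exact: open_neq.
pose h (v : 'cV[R]_n.+1) : 'cV[R]_n.+1 := (enorm v)^-1 *: v.
have oDB : open (D `&` h @^-1` B).
  rewrite openE => v [Dv hB].
  have ch : {for v, continuous h}.
    apply: continuousZ => //; apply: continuousV => //.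
    exact: enorm_continuous.
  apply: filterI; first exact: open_nbhs_nbhs.
  by apply: ch; exact: open_nbhs_nbhs.
have mA E : open E -> measurable (g @^-1` E).
  move=> oE; apply: open_measurable_sphere.
  by apply: open_comp => // x _; exact: cg.
have -> : Phi G @^-1` (set_val @^-1` B) =
    (g @^-1` (D `&` h @^-1` B)) `|`
    (~` (g @^-1` D) `&` [set _ | B (val (point : sphere R n))]).
  apply/seteqP; split => [x /= Bx|x /= [[Dx Bx]|[/negP]]].
  - have [gx0|gx0] := eqVneq (g x) 0.
      right; split; first by rewrite /D/= gx0 enorm_eq0 eqxx.
      by move: Bx; rewrite /Phi -/(g x) gx0 normalize0.
    left; split; first by rewrite /D/= enorm_eq0.
    by move: Bx; rewrite /Phi -/(g x) /set_val/= val_normalize.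
  - by rewrite /Phi -/(g x) /set_val/= val_normalize -?enorm_eq0.
  - rewrite negbK enorm_eq0 => /eqP gx0 Bp.
    by rewrite /Phi -/(g x) gx0 normalize0.
apply: measurableU; first exact: mA.
apply: measurableI; first by apply: measurableC; exact: mA.
have [Bp|nBp] := pselect (B (val (point : sphere R n))).
  by rewrite (_ : [set _ | _] = setT)//; apply/seteqP; split.
by rewrite (_ : [set _ | _] = set0)//; apply/seteqP; split.
Qed.

HB.instance Definition _ (R : realType) (n : nat) (G : 'M[R]_n.+1) :=
  isMeasurableFun.Build _ _ (sphere R n) (sphere R n) (Phi G)
    (measurable_Phi G).

Definition pushPhi (R : realType) (n : nat) (G : 'M[R]_n.+1)
    (mu : probability (sphere R n) R) : probability (sphere R n) R :=
  distribution mu (Phi G).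

(* The library constrains a measure only on measurable sets, so equality of
   measures means agreement on those. *)
Definition same_measure (R : realType) (n : nat)
    (mu nu : probability (sphere R n) R) : Prop :=
  forall A, measurable A -> mu A = nu A.

Definition coupling (R : realType) (n : nat)
    (mu nu : probability (sphere R n) R) :
    set (probability (sphere R n * sphere R n)%type R) :=
  [set pi : probability (sphere R n * sphere R n)%type R |
            (forall A, measurable A -> pi (A `*` setT) = mu A) /\
            (forall A, measurable A -> pi (setT `*` A) = nu A)].

Definition W1 (R : realType) (n : nat) (mu nu : probability (sphere R n) R) :
    \bar R :=
  ereal_inf [set (\int[pi]_z (enorm (val z.1 - val z.2))%:E)%E
            | pi in coupling mu nu].

Definition drift (R : realType) (n : nat)
    (F : probability (sphere R n) R -> 'M[R]_n.+1)
    (x : sphere R n) (mu : probability (sphere R n) R) : 'cV[R]_n.+1 :=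
  (1%:M - val x *m (val x)^T) *m F mu *m val x.

(* 0-homogeneous extension x |-> phi (x / ||x||), relevant for x != 0 only.
   phi is C^1 on the sphere iff its extension is C^1 off the origin, and the
   Euclidean gradient of the extension at a point of the sphere is tangent: it
   is the spherical gradient of phi. *)
Definition radial_ext (R : realType) (n : nat) (phi : sphere R n -> R) :
    'cV[R]_n.+1 -> R :=
  fun v => phi (normalize v).

Definition C1_sphere (R : realType) (n : nat) (phi : sphere R n -> R) : Prop :=
  forall v : 'cV[R]_n.+1, v != 0 ->
    differentiable (radial_ext phi) v /\
    (forall i : 'I_n.+1,
      {for v, continuous (fun w => 'D_(delta_mx i 0) (radial_ext phi) w)}).

Definition sgrad (R : realType) (n : nat) (phi : sphere R n -> R)
    (x : sphere R n) : 'cV[R]_n.+1 :=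
  \col_i 'D_(delta_mx i 0) (radial_ext phi) (val x).

Definition W1_continuous (R : realType) (n : nat)
    (rho : R -> probability (sphere R n) R) : Prop :=
  forall t, 0 <= t ->
    W1 (rho s) (rho t) @[s --> within `[0, +oo[ (nbhs t)] --> 0%E.

(* Curves on [0, +oo[ are functions on R whose values at t < 0 are ignored. *)
Definition weak_solution (R : realType) (n : nat)
    (F : probability (sphere R n) R -> 'M[R]_n.+1)
    (rho0 : probability (sphere R n) R)
    (rho : R -> probability (sphere R n) R) : Prop :=
  [/\ W1_continuous rho,
      same_measure (rho 0) rho0 &
      forall phi : sphere R n -> R, C1_sphere phi -> forall t, 0 <= t ->
        \int[rho t]_x phi x - \int[rho0]_x phi x =
        \int[lebesgue_measure]_(s in `[0, t])
          \int[rho s]_x ((sgrad phi x)^T *m drift F x (rho s)) 0 0].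

Definition SLpm (R : realType) (n : nat) : set 'M[R]_n.+1 :=
  [set G | `|\det G| = 1].
Arguments SLpm : clear implicits.

(* Derivative of a curve on [0, +oo[, one-sided at t = 0. *)
Definition has_derivative_on_nneg (R : realType) (n : nat)
    (G : R -> 'M[R]_n.+1) (t : R) (G' : 'M[R]_n.+1) : Prop :=
  h^-1 *: (G (t + h) - G t) @[h --> within [set h | 0 <= t + h] 0^'] --> G'.

(* Main.v *)
From HB Require Import structures.
Require Import Defs.
From mathcomp Require Import all_boot all_order all_algebra perm.
From mathcomp Require Import all_classical all_reals all_analysis.
From mathcomp Require Import measurable_realfun ring lra.

(** Along the given weak solution put A(t) := F[rho(t)], continuous in t.  Let G solve the
    linear equation G' = A G with G(0) = I, and H the equation H' = - H A with H(0) = I; then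
    H G = I, and det G = 1 by Jacobi's formula since tr A = 0.  For a 0-homogeneous function f
    that is C1 away from the origin, f(H(t) x) solves the backward transport equation dual to
    the continuity equation, so its integral against rho(t) does not depend on t.  Such f
    determine a measure, hence the pushforward of rho(t) by Phi_H(t) is rho_0, that is,
    rho(t) is the pushforward of rho_0 by Phi_G(t).  Since F only sees the measure, F[rho(t)]
    can then be replaced by F[(Phi_G(t))_# rho_0], which closes the equation for G. *)

Set Implicit Arguments.
Unset Strict Implicit.
Unset Printing Implicit Defensive.

Import Order.TTheory GRing.Theory Num.Theory.
Import numFieldNormedType.Exports.

Local Open Scope classical_set_scope.
Local Open Scope ring_scope.

(** * Derivatives of matrix-valued curves *)

(** Freezing the field along [rho] is what makes the problem linear: the coefficient is prescribed,
    so a series solution exists for all times. Two difficulties shape the rest. In the integral of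
    f(H(t) x) against rho(t) the measure and the integrand both move, while the time evolution of
    [rho] is known only in integrated form. The variation is therefore computed at a reference time
    s, once with the integrand frozen and once for the change of the integrand alone; the second
    part needs estimates uniform on the compact sphere together with narrow continuity of [rho]. The
    other difficulty is that the spherical gradient is defined through the radial extension. For a
    0-homogeneous f on the ambient space, f(H x) is its own radial extension away from the origin,
    so no map of the sphere ever has to be differentiated, and Euler's identity absorbs the
    projection in the drift. *)

Lemma is_derive_continuous (R : realType) (V : normedModType R) (f : R -> V) (x : R)
    (df : V) :
  is_derive x 1 f df -> {for x, continuous f}.
Proof. by move=> [/derivable1_diffP /differentiable_continuous]. Qed.

Lemma is_derive_mxP (R : realType) (m n : nat) (M : R -> 'M[R]_(m, n)) (x : R)
    (M' : 'M[R]_(m, n)) :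
  is_derive x 1 M M' <-> forall i j, is_derive x 1 (fun t => M t i j) (M' i j).
Proof.
split=> [[dM <-] i j|dM].
  split; first exact: (derivable_mxP M x 1).1.
  by rewrite derive_mx// mxE.
have dM' : derivable M x 1 by apply/derivable_mxP => i j; have [] := dM i j.
split => //; rewrite derive_mx//; apply/matrixP => i j; rewrite mxE.
exact: derive_val.
Qed.

Lemma antiderivative_right (R : realType) (f : R -> R) (a : R) :
  a < 0 -> continuous f ->
  exists F : R -> R, F 0 = 0 /\ forall x : R, a < x -> is_derive x 1 F (f x).
Proof.
move=> a0 cf.
pose P x := \int[lebesgue_measure]_(t in `[a, x]) f t.
exists (fun x => P x - P 0); split; first by rewrite subrr.
move=> x ax.
have [dP eP] : derivable P x 1 /\ P^`()%classic x = f x.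
  (* The endpoint [x + 1] only serves to make x interior to the interval of integration. *)
  apply: (@continuous_FTC1_closed R f a x (x + 1)) => //; last exact: cf.
    by rewrite ltrDl.
  apply: continuous_compact_integrable; first exact: segment_compact.
  exact: continuous_subspaceT.
rewrite -[f x]subr0; apply: is_deriveB.
by rewrite derive1E in eP; split.
Qed.

Lemma derive_unique (R : realType) (f F G : R -> R) (a b x : R) :
  (forall t, t \in `]a, b[ -> is_derive t 1 F (f t)) ->
  (forall t, t \in `]a, b[ -> is_derive t 1 G (f t)) ->
  0 \in `]a, b[ -> x \in `]a, b[ -> F 0 = G 0 -> F x = G x.
Proof.
move=> dF dG; rewrite !in_itv/= => /andP[a0 b0] /andP[ax xb] FG0.
suff H u v : a < u -> v < b -> u < v -> F u - G u = F v - G v.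
  have [x0|x0|->] := ltgtP x 0; last exact: FG0.
  - by have := H _ _ ax b0 x0; lra.
  - by have := H _ _ a0 xb x0; lra.
move=> au vb uv.
have dFG t : a < t -> t < b -> is_derive t 1 (F \- G) 0.
  move=> at_ tb; rewrite -(subrr (f t)).
  by apply: is_deriveB; [apply: dF|apply: dG]; rewrite in_itv/= at_ tb.
have dFG' t : t \in `]u, v[ -> is_derive t 1 (F \- G) 0.
  by rewrite in_itv/= => /andP[ut tv]; apply: dFG; lra.
have cFG : {within `[u, v], continuous (F \- G)}.
  apply: derivable_within_continuous => t; rewrite in_itv/= => /andP[ut tv].
  by have [] := dFG t (lt_le_trans au ut) (le_lt_trans tv vb).
have [c _] := MVT uv dFG' cFG.
by rewrite mul0r /=; lra.
Qed.

(* Glues the antiderivatives on ]-m-1, +oo[ given by integration; they agree with one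
   another because they all vanish at 0. *)
Lemma antiderivative (R : realType) (f : R -> R) : continuous f ->
  exists F : R -> R, F 0 = 0 /\ forall x : R, is_derive x 1 F (f x).
Proof.
move=> cf.
have H (m : nat) : exists F : R -> R, F 0 = 0 /\
    forall x : R, - m.+1%:R < x -> is_derive x 1 F (f x).
  by apply: antiderivative_right; rewrite // oppr_lt0.
have [P HP] := choice H.
exists (fun x => P (Num.truncn `|x|) x); split; first exact: (HP _).1.
(* With m one larger than the integer part of |x|, the ball |t| < m is a neighbourhood of x on which
   every piece in use agrees with [P m]. *)
move=> x; pose m := (Num.truncn `|x|).+1.
have Hm t : `|t| < m%:R -> P (Num.truncn `|t|) t = P m t.
  move=> tm; pose k := Num.truncn `|t|.
  have tk : `|t| < k.+1%:R by rewrite truncnS_gt.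
  apply: (@derive_unique R f _ _ (- k.+1%:R) m%:R) => [s|s|||].
  - by rewrite in_itv/= => /andP[? _]; apply: (HP _).2.
  - rewrite in_itv/= => /andP[ks _]; apply: (HP _).2; apply: le_lt_trans ks.
    rewrite lerN2 ler_nat ltnS ltnW// -(ltr_nat R).
    by apply: le_lt_trans tm; rewrite truncn_le.
  - by rewrite in_itv/= oppr_lt0 !ltr0n.
  - by rewrite in_itv/=; move: tk tm; rewrite !ltr_norml => /andP[-> _] /andP[_ ->].
  - by rewrite !(HP _).1.
have xm : `|x| < m%:R by rewrite truncnS_gt.
apply: (@near_eq_is_derive _ _ _ (P m)).
  have : \forall t \near x, `|t| < m%:R.
    exact: (cvgr_lt _ (@norm_continuous _ _ x) _ xm).
  by apply: filterS => t /Hm.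
apply: (HP m).2; move: xm; rewrite ltr_norml => /andP[+ _].
by apply: lt_trans; rewrite ltrN2 ltr_nat.
Qed.

Lemma mx_norm_leP (R : realType) (m n : nat) (M : 'M[R]_(m, n)) (b : R) : 0 <= b ->
  reflect (forall i j, `|M i j| <= b) (`|M| <= b).
Proof.
move=> b0; rewrite [`|M|]mx_normrE; apply: (iffP (bigmax_leP _ _ _ _)).
  by move=> [_ H] i j; exact: (H (i, j)).
by move=> H; split => // -[i j] _; exact: H.
Qed.

Lemma ler_mx_norm (R : realType) (m n : nat) (M : 'M[R]_(m, n)) i j : `|M i j| <= `|M|.
Proof. by move: i j; apply/(mx_norm_leP M). Qed.

(** The entrywise sup norm is submultiplicative only up to the inner dimension; this is the origin
    of the factor [n%:R] in the constants of the Picard estimates. *)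
Lemma mx_normM (R : realType) (m n p : nat) (A : 'M[R]_(m, n)) (B : 'M[R]_(n, p)) :
  `|A *m B| <= n%:R * `|A| * `|B|.
Proof.
apply/mx_norm_leP => [|i j]; first by rewrite !mulr_ge0.
rewrite mxE; apply: le_trans (ler_norm_sum _ _ _) _.
rewrite -[n in n%:R]card_ord -sumr_const !mulr_suml; apply: ler_sum => k _.
by rewrite mul1r normrM ler_pM ?ler_mx_norm.
Qed.

Lemma mx_cvgP (R : realType) (T : Type) (F : set_system T) {FF : Filter F} (m n : nat)
    (f : T -> 'M[R]_(m, n)) (M : 'M[R]_(m, n)) :
  f @ F --> M <-> forall i j, f x i j @[x --> F] --> M i j.
Proof.
split=> [fM i j|fM].
  exact: (cvg_comp _ _ fM (@coord_continuous _ _ _ i j M)).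
apply/cvgrPdist_le => e e0.
have : \forall x \near F, forall ij : 'I_m * 'I_n, `|M ij.1 ij.2 - f x ij.1 ij.2| <= e.
  by apply: filter_forall => ij; have /cvgrPdist_le := fM ij.1 ij.2; exact.
apply: filterS => x H; apply/(mx_norm_leP _ (ltW e0)) => i j.
by rewrite !mxE; exact: (H (i, j)).
Qed.

Lemma mulmx_cvg (R : realType) (T : Type) (F : set_system T) {FF : Filter F} (m n p : nat)
    (f : T -> 'M[R]_(m, n)) (g : T -> 'M[R]_(n, p))
    (A : 'M[R]_(m, n)) (B : 'M[R]_(n, p)) :
  f @ F --> A -> g @ F --> B -> f x *m g x @[x --> F] --> A *m B.
Proof.
move=> /mx_cvgP fA /mx_cvgP gB; apply/mx_cvgP => i j; rewrite mxE.
under eq_fun do rewrite mxE.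
apply: cvg_big => [x|k _]; [exact: add_continuous|].
by apply: cvgM; [exact: fA|exact: gB].
Qed.

Lemma is_derive_ext (R : numFieldType) (V W : normedModType R) (f g : V -> W)
    (x v : V) (df dg : W) :
  is_derive x v f df -> f =1 g -> df = dg -> is_derive x v g dg.
Proof. by move=> + /funext <- <-. Qed.

Lemma is_derive_mulmx (R : realType) (m n p : nat) (x : R)
    (f : R -> 'M[R]_(m, n)) (g : R -> 'M[R]_(n, p))
    (A : 'M[R]_(m, n)) (B : 'M[R]_(n, p)) :
  is_derive x 1 f A -> is_derive x 1 g B ->
  is_derive x 1 (fun t => f t *m g t) (A *m g x + f x *m B).
Proof.
move=> /is_derive_mxP fA /is_derive_mxP gB; apply/is_derive_mxP => i j.
under eq_fun do rewrite mxE.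
have -> : (fun t => \sum_k f t i k * g t k j) = \sum_k (fun t => f t i k * g t k j).
  by apply/funext => t; rewrite fct_sumE.
rewrite !mxE -big_split/=; apply: is_derive_sum => k.
apply: (is_derive_ext (is_deriveM (fA i k) (gB k j))) => //.
by rewrite addrC; congr (_ + _); exact: mulrC.
Qed.

Lemma mx_antiderivative (R : realType) (m n : nat) (f : R -> 'M[R]_(m, n)) :
  continuous f ->
  exists P : R -> 'M[R]_(m, n), P 0 = 0 /\ forall x : R, is_derive x 1 P (f x).
Proof.
move=> cf.
have H (ij : 'I_m * 'I_n) : exists P : R -> R, P 0 = 0 /\
    forall x : R, is_derive x 1 P (f x ij.1 ij.2).
  apply: antiderivative => x.
  by have /mx_cvgP := cf x; exact.
have [P HP] := choice H.
exists (fun x => \matrix_(i, j) P (i, j) x); split.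
  by apply/matrixP => i j; rewrite !mxE (HP _).1.
move=> x; apply/is_derive_mxP => i j; under eq_fun do rewrite mxE.
exact: (HP (i, j)).2.
Qed.

(* Integrates the bound |f'| <= c |s|^k; iterating it gives the factorial decay of the
   Picard terms. *)
Lemma derive_le_monomial (R : realType) (f f' : R -> R) (c t : R) (k : nat) :
  0 <= t -> (forall s : R, is_derive s 1 f (f' s)) -> f 0 = 0 ->
  (forall s, 0 <= s <= t -> f' s <= c * s ^+ k) ->
  f t <= c * (t ^+ k.+1 / k.+1%:R).
Proof.
move=> t0 df f0 f'le.
pose q (s : R) := c * (s ^+ k.+1 / k.+1%:R).
have dq (s : R) : is_derive s 1 q (c * s ^+ k).
  apply: (is_derive_ext (is_deriveZ (c / k.+1%:R) (is_deriveX k.+1 (is_derive_id s 1)))).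
    by move=> y; rewrite /q exprfctE /GRing.scale/= /GRing.scale/=; ring.
  by rewrite /GRing.scale/= mulr1; field.
have dqf (s : R) : is_derive s 1 (q \- f) (c * s ^+ k - f' s) by apply: is_deriveB.
have cqf : {within `[0, t], continuous (q \- f)}.
  by apply: derivable_within_continuous => s _; have [] := dqf s.
have [s st] := MVT_segment t0 (fun s _ => dqf s) cqf.
rewrite /= f0 /q expr0n/= mul0r mulr0 !subr0 => e.
by rewrite -subr_ge0 e mulr_ge0// subr_ge0 f'le.
Qed.

(** The one-sided bound is applied to f and to its opposite; negative times are reached by
    reflecting the argument. *)
Lemma derive_bound_monomial (R : realType) (f f' : R -> R) (c t : R) (k : nat) :
  (forall s : R, is_derive s 1 f (f' s)) -> f 0 = 0 ->
  (forall s, `|s| <= `|t| -> `|f' s| <= c * `|s| ^+ k) ->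
  `|f t| <= c * (`|t| ^+ k.+1 / k.+1%:R).
Proof.
move=> df f0 f'le.
have pos (g g' : R -> R) : (forall s : R, is_derive s 1 g (g' s)) -> g 0 = 0 ->
    (forall s, `|s| <= `|t| -> `|g' s| <= c * `|s| ^+ k) ->
    `|g `|t| | <= c * (`|t| ^+ k.+1 / k.+1%:R).
  move=> dg g0 g'le; rewrite ler_norml lerNl; apply/andP; split.
    apply: (@derive_le_monomial _ (- g) (fun s => - g' s)) => //.
      by rewrite fctE g0 oppr0.
    move=> s /andP[s0 st]; apply: le_trans (ler_norm _) _.
    by rewrite normrN -{2}(ger0_norm s0) g'le// ger0_norm.
  apply: (@derive_le_monomial _ g g') => // s /andP[s0 st].
  by apply: le_trans (ler_norm _) _; rewrite -{2}(ger0_norm s0) g'le// ger0_norm.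
have [t0|t0] := leP 0 t.
  by rewrite -{1}(ger0_norm t0); exact: (pos f f').
have -> : f t = f (- `|t|) by rewrite ltr0_norm// opprK.
apply: (pos (f \o -%R) (fun s => f' (- s) * -1)).
- by rewrite /comp oppr0.
- by move=> s st; rewrite mulrN1 normrN -(normrN s) f'le// normrN.
Qed.

(** * Linear differential equations *)

Lemma continuous_mx_bounded (R : realType) (m n : nat) (A : R -> 'M[R]_(m, n)) (T : R) :
  continuous A -> exists2 K : R, 0 <= K & forall t, `|t| <= T -> `|A t| <= K.
Proof.
move=> cA; have [M [_ HM]] : bounded_set ((fun t => `|A t|) @` `[- T, T]).
  apply: compact_bounded; apply: continuous_compact; last exact: segment_compact.
  apply: continuous_subspaceT => t.
  exact: (continuous_comp (cA t) (@norm_continuous _ _ (A t))).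
(* [bounded_set] gives the bound only for numbers strictly above [M]. *)
exists (`|M| + 1) => [|t tT]; first by rewrite addr_ge0.
rewrite -[leLHS]normr_id; apply: HM; last by exists t => //=; rewrite in_itv/= -ler_norml.
by apply: le_lt_trans (ler_norm _) _; rewrite ltrDl.
Qed.

Section linear_ode_existence.
Variables (R : realType) (n : nat) (A : R -> 'M[R]_n).
Hypothesis cA : continuous A.

(** Choice turns antidifferentiation into an operator that can be iterated; on functions that are
    not continuous it takes a junk value. *)
Lemma antiderivative_operator : exists I : (R -> 'M[R]_n) -> R -> 'M[R]_n, forall f,
  continuous f -> I f 0 = 0 /\ forall x : R, is_derive x 1 (I f) (f x).
Proof.
have H (f : R -> 'M[R]_n) : exists P : R -> 'M[R]_n,
    continuous f -> P 0 = 0 /\ forall x : R, is_derive x 1 P (f x).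
  have [cf|ncf] := pselect (continuous f); last by exists 0.
  by have [P HP] := mx_antiderivative cf; exists P.
by have [I HI] := choice H; exists I.
Qed.

Let prim := projT1 (cid antiderivative_operator).
Let prim0 f : continuous f -> prim f 0 = 0.
Proof. by move=> /(projT2 (cid antiderivative_operator))[]. Qed.
Let prim_derive f (x : R) : continuous f -> is_derive x 1 (prim f) (f x).
Proof. by move=> /(projT2 (cid antiderivative_operator))[]. Qed.

(** The terms of the Peano-Baker series, each the primitive of A times the previous one. The usual
    Picard iterates are their partial sums [S]. *)
Let picard k := iter k (fun Q => prim (fun t => A t *m Q t)) (cst 1%:M).

Let mulA_continuous (Q : R -> 'M[R]_n) : continuous Q -> continuous (fun t => A t *m Q t).
Proof. by move=> cQ t; apply: mulmx_cvg; [exact: cA|exact: cQ]. Qed.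

Let picard_continuous k : continuous (picard k).
Proof.
elim: k => [|k IH] t; first exact: cvg_cst.
exact: (is_derive_continuous (prim_derive t (mulA_continuous IH))).
Qed.

Let picard_derive k (t : R) : is_derive t 1 (picard k.+1) (A t *m picard k t).
Proof. exact: (prim_derive t (mulA_continuous (@picard_continuous k))). Qed.

(** The terms are dominated by those of the exponential series: multiplying by A costs [n%:R * K],
    and integrating the monomial of degree k yields the missing factor |t|^(k+1) / (k+1). *)
Let picard_bound (T K : R) k t : 0 <= K -> (forall t, `|t| <= T -> `|A t| <= K) ->
  `|t| <= T -> `|picard k t| <= exp_coeff (n%:R * K * `|t|) k.
Proof.
move=> K0 HK; elim: k t => [|k IH] t tT.
  rewrite /exp_coeff/= expr0 fact0 invr1 mulr1.
  apply/mx_norm_leP => // i j; rewrite !mxE; case: eqP => _; rewrite ?normr1 ?normr0 //.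
apply/mx_norm_leP => [|i j].
  by rewrite /exp_coeff/= divr_ge0 ?exprn_ge0 ?mulr_ge0.
have -> : exp_coeff (n%:R * K * `|t|) k.+1 =
    (n%:R * K) * (n%:R * K) ^+ k / k`!%:R * (`|t| ^+ k.+1 / k.+1%:R).
  rewrite /exp_coeff/= factS natrM invfM exprMn !exprS; ring.
apply: (@derive_bound_monomial _ (fun s => picard k.+1 s i j)
  (fun s => (A s *m picard k s) i j)).
- by move=> s; have /is_derive_mxP := picard_derive k s; exact.
- by rewrite /= prim0 ?mxE//; exact: mulA_continuous.
move=> s st; have sT := le_trans st tT.
apply: le_trans (ler_mx_norm _ i j) _; apply: le_trans (mx_normM _ _) _.
have -> : n%:R * K * (n%:R * K) ^+ k / k`!%:R * `|s| ^+ k =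
    n%:R * K * exp_coeff (n%:R * K * `|s|) k.
  by rewrite /exp_coeff/= [(_ * `|s|) ^+ k]exprMn; ring.
by rewrite ler_pM ?mulr_ge0// ?ler_wpM2l ?HK// IH.
Qed.

Let S k t := \sum_(i < k) picard i t.

Let S_continuous k : continuous (S k).
Proof.
apply: continuous_big => [x|i _]; first exact: add_continuous.
exact: picard_continuous.
Qed.

(** The index drops by one because the constant term disappears and each remaining term
    differentiates to A times its predecessor. *)
Let S_derive k (t : R) : is_derive t 1 (S k.+1) (A t *m S k t).
Proof.
have H : is_derive t 1 (cst 1%:M + \sum_(i < k) picard i.+1)
    (0 + \sum_(i < k) A t *m picard i t).
  apply: is_deriveD; apply: is_derive_sum => i; exact: picard_derive.
apply: (is_derive_ext H) => [s|]; last by rewrite add0r mulmx_sumr.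
transitivity (1%:M + (\sum_(i < k) picard i.+1) s); first by [].
by rewrite fct_sumE /S big_ord_recl.
Qed.

(** Uniformity on |t| <= T comes from comparing the tails with those of the exponential series at
    the single point [n%:R * K * T]. *)
Let S_cauchy (T e : R) : 0 < e -> exists N, forall k l t, (N <= k)%N -> (k <= l)%N ->
  `|t| <= T -> `|S l t - S k t| <= e.
Proof.
move=> e0; have [T0|T0] := ltP T 0.
  by exists 0%N => k l t _ _ tT; have := le_lt_trans tT T0; rewrite ltNge normr_ge0.
have [K K0 HK] := continuous_mx_bounded T cA.
have /cauchy_cvgP/cauchy_seriesP/(_ e e0)[[U V] /=[[N1 _ HU] [N2 _ HV]] UV] :=
  @is_cvg_series_exp_coeff R (n%:R * K * T).
exists (maxn N1 N2) => k l t; rewrite geq_max => /andP[k1 k2] kl tT.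
have : `|\sum_(k <= i < l) exp_coeff (n%:R * K * T) i| < e.
  by apply: (UV (k, l)); split; [exact: HU|apply: HV; exact: leq_trans kl].
move=> /ltW; apply: le_trans; apply: le_trans (ler_norm _).
rewrite /S -!(big_mkord xpredT (fun i => picard i t)) (big_cat_nat (n := k))//=.
rewrite addrAC subrr add0r.
apply: le_trans (ler_norm_sum _ _ _) _; apply: ler_sum => i _.
apply: le_trans (picard_bound i K0 HK tT) _.
rewrite /exp_coeff/= ler_wpM2r ?invr_ge0// lerXn2r ?nnegrE ?mulr_ge0//.
by rewrite ler_wpM2l ?mulr_ge0.
Qed.

Let S_lim : exists X : R -> 'M[R]_n, forall (T e : R), 0 < e ->
  exists N, forall k t, (N <= k)%N -> `|t| <= T -> `|X t - S k t| <= e.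
Proof.
have cS t i j : cvgn (fun k => S k t i j).
  apply/cauchy_cvgP/cauchy_exP => e e0.
  have e2 : 0 < e / 2 by rewrite divr_gt0.
  have [N HN] := S_cauchy `|t| e2.
  exists (S N t i j); exists N => // k /= Nk; rewrite -ball_normE /=.
  apply: (@le_lt_trans _ _ (e / 2)); last by rewrite ltr_pdivrMr// ltr_pMr// ltr1n.
  have -> : S N t i j - S k t i j = (S N t - S k t) i j by rewrite !mxE.
  by apply: le_trans (ler_mx_norm _ i j) _; rewrite distrC HN.
exists (fun t => \matrix_(i, j) limn (fun k => S k t i j)) => T e e0.
have [N HN] := S_cauchy T e0; exists N => k t Nk tT.
apply/mx_norm_leP => [|i j]; first exact: ltW.
rewrite !mxE distrC.
have H : `|S k t i j - S l t i j| @[l --> \oo] -->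
    `|S k t i j - limn (fun k => S k t i j)|.
  by apply: cvg_norm; apply: cvgB; [exact: cvg_cst|exact: cS].
apply: (cvgr_to_le H); exists k => // l /= kl.
have -> : S k t i j - S l t i j = (S k t - S l t) i j by rewrite !mxE.
by apply: le_trans (ler_mx_norm _ i j) _; rewrite distrC HN.
Qed.

(** The limit is not differentiated term by term. It is shown to satisfy the integral equation X = 1
    + Y, with [Y] a primitive of A X, by bounding the defect by every e > 0; differentiability of X
    follows from that of [Y]. *)
Lemma linear_ode : exists X : R -> 'M[R]_n,
  X 0 = 1%:M /\ forall t : R, is_derive t 1 X (A t *m X t).
Proof.
have [X HX] := S_lim.
have cX : continuous X.
  move=> t; apply/cvgrPdist_le => e e0.
  have e3 : 0 < e / 3 by rewrite divr_gt0.
  have [N HN] := HX (`|t| + 1) _ e3.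
  have : \forall s \near t, `|s| <= `|t| + 1.
    by apply: (cvgr_le _ (@norm_continuous _ _ t)); rewrite ltrDl.
  have : \forall s \near t, `|S N t - S N s| <= e / 3.
    by have /cvgrPdist_le := @S_continuous N t; exact.
  apply: filterS2 => s sN st.
  have -> : X t - X s = (X t - S N t) + (S N t - S N s) + (S N s - X s).
    by rewrite !addrA !subrK.
  have -> : e = e / 3 + e / 3 + e / 3 by lra.
  apply: le_trans (ler_normD _ _) _; apply: lerD; last by rewrite distrC HN.
  apply: le_trans (ler_normD _ _) _; apply: lerD => //.
  by rewrite HN// lerDl.
pose Y := prim (fun t => A t *m X t).
have dY (t : R) : is_derive t 1 Y (A t *m X t).
  by apply: prim_derive; exact: mulA_continuous.
suff XY t : X t = 1%:M + Y t.
  exists X; split; first by rewrite XY /Y prim0 ?addr0//; exact: mulA_continuous.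
  move=> t; have H : is_derive t 1 (cst 1%:M + Y) (0 + A t *m X t) by apply: is_deriveD.
  by apply: (is_derive_ext H) => [s|]; [rewrite XY|rewrite add0r].
have [K K0 HK] := continuous_mx_bounded `|t| cA.
(* Replacing X by a partial sum costs e / c, and integrating the error of [S N] costs e / c times
   [n%:R * K * |t|]; c makes the two add up to e. *)
pose c := n%:R * K * `|t| + 1.
have c0 : 0 < c by rewrite ltr_wpDl ?mulr_ge0.
apply/eqP; rewrite -subr_eq0 -normr_eq0 eq_le normr_ge0 andbT.
apply/ler_addgt0Pl => e e0; rewrite addr0.
have [N HN] := HX `|t| _ (divr_gt0 e0 c0).
have -> : X t - (1%:M + Y t) = (X t - S N.+1 t) + (S N.+1 t - 1%:M - Y t).
  by rewrite opprD !addrA subrK.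
have -> : e = e / c + e / c * (n%:R * K * `|t|).
  by rewrite -[X in _ = X + _]mulr1 -mulrDr [1 + _]addrC -/c divfK// gt_eqF.
apply: le_trans (ler_normD _ _) _; apply: lerD; first by rewrite HN.
apply/mx_norm_leP => [|i j]; first by rewrite !mulr_ge0 ?invr_ge0 ?(ltW e0) ?(ltW c0).
have -> : e / c * (n%:R * K * `|t|) = (e / c * (n%:R * K)) * (`|t| ^+ 1 / 1%:R).
  by rewrite divr1 expr1; ring.
have dZ (s : R) : is_derive s 1 (S N.+1 - cst 1%:M - Y) (A s *m S N s - 0 - A s *m X s).
  by have dS := S_derive N s; do 2!apply: is_deriveB.
apply: (@derive_bound_monomial _ (fun s => (S N.+1 - cst 1%:M - Y) s i j)
  (fun s => (A s *m S N s - 0 - A s *m X s) i j)).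
- by move=> s; have /is_derive_mxP := dZ s; exact.
- rewrite !fctE /Y prim0; last exact: mulA_continuous.
  rewrite /S big_ord_recl big1 ?addr0 ?subrr ?subr0 ?mxE // => k _.
  by rewrite /= prim0//; exact: mulA_continuous.
move=> s st; apply: le_trans (ler_mx_norm _ i j) _.
rewrite subr0 -mulmxBr expr0 mulr1; apply: le_trans (mx_normM _ _) _.
by rewrite [leRHS]mulrC ler_pM ?mulr_ge0// ?ler_wpM2l ?HK// distrC HN.
Qed.

End linear_ode_existence.

(** * Jacobi's formula and the linear flow with its inverse *)

Lemma is_derive_prod (R : realType) (n : nat) (f : 'I_n -> R -> R) (f' : 'I_n -> R)
    (x : R) :
  (forall i, is_derive x 1 (f i) (f' i)) ->
  is_derive x 1 (fun t => \prod_i f i t) (\sum_i \prod_j if j == i then f' j else f j x).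
Proof.
elim: n f f' => [|n IH] f f' df.
  rewrite big_ord0; under eq_fun do rewrite big_ord0; exact: is_derive_cst.
have H := IH _ _ (fun i => df (lift ord0 i)).
apply: (is_derive_ext (is_deriveM (df ord0) H)) => [t|]; first by rewrite big_ord_recl.
rewrite big_ord_recl/= addrC; congr (_ + _).
  by rewrite big_ord_recl eqxx mulrC.
rewrite /GRing.scale/= mulr_sumr; apply: eq_bigr => i _.
by rewrite big_ord_recl.
Qed.

Lemma is_derive_det (R : realType) (n : nat) (X : R -> 'M[R]_n) (X' : 'M[R]_n) (x : R) :
  is_derive x 1 X X' -> is_derive x 1 (fun t => \det (X t)) (\tr (X' *m \adj (X x))).
Proof.
move=> /is_derive_mxP dX.
(* [Y i] is X with its row i differentiated. The cofactors along that row are those of X, so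
   expanding there gives the i-th diagonal entry of X' adj(X). *)
pose Y i : 'M[R]_n := \matrix_(j, k) if j == i then X' j k else X x j k.
have -> : \tr (X' *m \adj (X x)) = \sum_i \det (Y i).
  rewrite /mxtrace; apply: eq_bigr => i _.
  rewrite (expand_det_row _ i) mxE; apply: eq_bigr => k _.
  rewrite !mxE eqxx; congr (_ * (_ * \det _)).
  by apply/matrixP => a b; rewrite !mxE eq_sym (negbTE (neq_lift _ _)).
have -> : \sum_i \det (Y i) =
    \sum_(s : 'S_n) (-1) ^+ s * \sum_i \prod_j if j == i then X' j (s j) else X x j (s j).
  rewrite exchange_big/=; apply: eq_bigr => s _; rewrite mulr_sumr.
  by apply: eq_bigr => i _; congr (_ * _); apply: eq_bigr => j _; rewrite mxE.
rewrite /determinant.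
elim: (index_enum _) => [|s r IH].
  by rewrite big_nil; under eq_fun do rewrite big_nil; exact: is_derive_cst.
rewrite big_cons; under eq_fun do rewrite big_cons.
apply: is_deriveD; apply: is_deriveZ.
by apply: is_derive_prod => j; exact: dX.
Qed.

Lemma linear_flow (R : realType) (n : nat) (A : R -> 'M[R]_n) :
  continuous A -> (forall t, \tr (A t) = 0) ->
  exists G H : R -> 'M[R]_n, [/\ G 0 = 1%:M,
    forall t : R, is_derive t 1 G (A t *m G t),
    forall t : R, is_derive t 1 H (- (H t *m A t)),
    forall t, H t *m G t = 1%:M &
    forall t, \det (G t) = 1].
Proof.
move=> cA trA; have [G [G0 dG]] := linear_ode cA.
(* In the equation for H the coefficient stands on the right; transposing brings it to the form
   solved by [linear_ode]. *)
have cB : continuous (fun t => - (A t)^T).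
  move=> t; apply/mx_cvgP => i j; rewrite !mxE.
  under eq_fun do rewrite !mxE.
  by apply: cvgN; have /mx_cvgP := cA t; exact.
have [Y [Y0 dY]] := linear_ode cB.
have dH (t : R) : is_derive t 1 (fun s => (Y s)^T) (- ((Y t)^T *m A t)).
  apply/is_derive_mxP => i j; under eq_fun do rewrite mxE.
  have /is_derive_mxP/(_ j i) := dY t.
  by rewrite mulNmx -[(A t)^T *m Y t]trmxK trmx_mul trmxK !mxE.
exists G, (fun s => (Y s)^T); split => // t.
  apply/matrixP => i j.
  pose f s := ((Y s)^T *m G s) i j.
  have -> : (1%:M : 'M[R]_n) i j = f 0 by rewrite /f G0 Y0 trmx1 mul1mx.
  apply: (is_derive_0_is_cst (f := f)) => s.
  have /is_derive_mxP/(_ i j) := is_derive_mulmx (dH s) (dG s).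
  by rewrite mulNmx mulmxA addNr mxE.
have -> : 1 = \det (G 0) by rewrite G0 det1.
apply: (is_derive_0_is_cst (f := fun s => \det (G s))) => s.
have := is_derive_det (dG s).
by rewrite -mulmxA mul_mx_adj mul_mx_scalar mxtraceZ trA mulr0.
Qed.

(** * Functions of class C1 away from the origin *)

Lemma near_eq_diff (R : numFieldType) (V W : normedModType R) (f g : V -> W) (x : V) :
  differentiable f x -> {near x, f =1 g} ->
  differentiable g x /\ 'd g x = 'd f x :> (V -> W).
Proof.
move=> df fg; have [cdf] := (diff_locallyP x f).1 df => /eqaddoP fE.
have gE : g \o shift x = cst (g x) + 'd f x +o_ 0 id.
  apply/eqaddoP => e e0; have := fE e e0.
  have : \forall h \near 0, f (h + x) = g (h + x).
    suff : h + x @[h --> (0 : V)] --> x by move=> /(_ _ fg).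
    by rewrite -[X in _ --> X]add0r; apply: cvgD; [exact: cvg_id|exact: cvg_cst].
  by apply: filterS2 => h /= fgh; rewrite !fctE/= fgh (nbhs_singleton fg).
have dgE := diff_unique cdf gE.
split; last exact: dgE.
by apply/diff_locallyP; rewrite dgE; split.
Qed.

Section C1_off0.
Variables (R : realType) (V : normedModType R).

(* Test functions are kept as functions on R^d, continuously differentiable away from 0,
   so that composing with an invertible matrix stays in the class. *)
Definition C1_off0 (f : V -> R) := forall v, v != 0 ->
  differentiable f v /\ forall u, {for v, continuous (fun w => 'd f w u)}.

Lemma near_neq0 (v : V) : v != 0 -> \forall w \near v, w != 0.
Proof. by move=> v0; apply: (cvgr_neq0 v). Qed.

Lemma C1_off0_build (f : V -> R) (df : V -> V -> R) :
  (forall v, v != 0 -> is_diff v f (df v)) ->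
  (forall v u, v != 0 -> {for v, continuous (fun w => df w u)}) -> C1_off0 f.
Proof.
move=> fdf cdf v v0; have [dfv ev] := fdf v v0; split => // u.
rewrite /prop_for /continuous_at ev.
apply: cvg_trans (cdf v u v0); apply: near_eq_cvg.
by apply: filterS (near_neq0 v0) => w /fdf[_ ->].
Qed.

Lemma C1_off0_is_diff (f : V -> R) v : C1_off0 f -> v != 0 -> is_diff v f ('d f v).
Proof. by move=> cf /cf[? _]; exact: differentiableP. Qed.

Lemma C1_off0_continuous (f : V -> R) v : C1_off0 f -> v != 0 -> {for v, continuous f}.
Proof. by move=> cf /cf[? _]; exact: differentiable_continuous. Qed.

(** The complement of the origin is open, so the values at 0 have no influence. This matters for
    radial extensions, whose value at 0 is arbitrary. *)
Lemma C1_off0_eq (f g : V -> R) : C1_off0 f -> (forall v, v != 0 -> f v = g v) ->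
  C1_off0 g /\ forall v, v != 0 -> 'd g v = 'd f v :> (V -> R).
Proof.
move=> cf fg.
have H v : v != 0 -> is_diff v g ('d f v).
  move=> v0; have [df _] := cf _ v0.
  have [dg e] := near_eq_diff df (filterS fg (near_neq0 v0)).
  by rewrite -e; exact: differentiableP.
split; last by move=> v /H[].
by apply: C1_off0_build H _ => v u /cf[_]; exact.
Qed.

Lemma C1_off0_cst (c : R) : C1_off0 (fun _ => c).
Proof.
apply: (@C1_off0_build _ (fun _ _ => 0)) => // v u _; exact: cst_continuous.
Qed.

Lemma C1_off0M (f g : V -> R) : C1_off0 f -> C1_off0 g -> C1_off0 (f * g).
Proof.
move=> cf cg.
apply: (@C1_off0_build (f * g) (fun v u => f v * 'd g v u + g v * 'd f v u)).
  by move=> v v0; apply: is_diffM; exact: C1_off0_is_diff.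
move=> v u v0; have [_ cdf] := cf _ v0; have [_ cdg] := cg _ v0.
by apply: continuousD; apply: continuousM => //; exact: C1_off0_continuous.
Qed.

Lemma C1_off0D (f g : V -> R) : C1_off0 f -> C1_off0 g -> C1_off0 (f + g).
Proof.
move=> cf cg.
apply: (@C1_off0_build (f + g) (fun v u => 'd f v u + 'd g v u)).
  by move=> v v0; apply: is_diffD; exact: C1_off0_is_diff.
move=> v u v0; have [_ cdf] := cf _ v0; have [_ cdg] := cg _ v0.
by apply: continuousD.
Qed.

Lemma C1_off0_comp (f : V -> R) (h h' : R -> R) : C1_off0 f ->
  (forall v, v != 0 -> is_derive (f v) 1 h (h' (f v))) ->
  (forall v, v != 0 -> {for f v, continuous h'}) -> C1_off0 (h \o f).
Proof.
move=> cf dh ch'.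
apply: (@C1_off0_build (h \o f) (fun v u => 'd f v u * h' (f v))).
  move=> v v0; have df := C1_off0_is_diff cf v0.
  have [dhf hfE] := dh v v0.
  have ddh : is_diff (f v) h ( *:%R^~ (h' (f v))).
    by split; [exact/derivable1_diffP|rewrite deriv1E// derive1E hfE].
  exact: is_diff_comp.
move=> v u v0; apply: continuousM; first by have [_] := cf v v0; exact.
by apply: continuous_comp; [exact: C1_off0_continuous|exact: ch'].
Qed.

Lemma C1_off0_derive_continuous (f : V -> R) (u v : V) :
  C1_off0 f -> v != 0 -> {for v, continuous (fun w => 'D_u f w)}.
Proof.
move=> cf v0; have [df cdf] := cf v v0.
rewrite /prop_for /continuous_at deriveE//.
apply: cvg_trans (cdf u); apply: near_eq_cvg.
by apply: filterS (near_neq0 v0) => w /cf[dw _]; rewrite deriveE.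
Qed.

Lemma C1_off0V (f : V -> R) : C1_off0 f -> (forall v, v != 0 -> f v != 0) ->
  C1_off0 (fun v => (f v)^-1).
Proof.
move=> cf f0; apply: (@C1_off0_comp f GRing.inv (fun x => - x ^- 2)) => // v /f0 fv0.
  split; first by apply: derivableV => //; exact: derivable_id.
  by rewrite (deriveV (f := id))// derive_id /GRing.scale/= mulr1.
apply: continuousN; apply: continuousV; first by rewrite sqrf_eq0.
exact: exprn_continuous.
Qed.

Lemma C1_off0_sum (I : Type) (r : seq I) (f : I -> V -> R) :
  (forall i, C1_off0 (f i)) -> C1_off0 (fun v => \sum_(i <- r) f i v).
Proof.
move=> cf; elim: r => [|i r IH].
  under eq_fun do rewrite big_nil.
  exact: C1_off0_cst.
under eq_fun do rewrite big_cons.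
exact: (C1_off0D (cf i) IH).
Qed.

Lemma C1_off0_prod (I : Type) (r : seq I) (f : I -> V -> R) :
  (forall i, C1_off0 (f i)) -> C1_off0 (fun v => \prod_(i <- r) f i v).
Proof.
move=> cf; elim: r => [|i r IH].
  under eq_fun do rewrite big_nil.
  exact: C1_off0_cst.
under eq_fun do rewrite big_cons.
exact: (C1_off0M (cf i) IH).
Qed.

Lemma diffBZ (f : V -> R) (v a b : V) (c : R) :
  'd f v (a - c *: b) = 'd f v a - c * 'd f v b.
Proof. by rewrite linearB linearZ. Qed.

(** Near h = 0 the factor 1 + h is positive, so f is constant along (1 + h) v. *)
Lemma homogeneous_euler (f : V -> R) (v : V) : v != 0 -> C1_off0 f ->
  (forall a w, 0 < a -> f (a *: w) = f w) -> 'd f v v = 0.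
Proof.
move=> v0 /(_ v v0)[df _] hf; rewrite -deriveE// /derive.
apply/cvg_lim => //; apply: cvg_near_cst.
apply: cvg_within; have : \forall h \near 0, - 1 < h :> R.
  by apply: (cvgr_gt _ (@cvg_id _ (nbhs (0 : R)))); rewrite oppr_lt0.
apply: filterS => h h1; rewrite (_ : (f \o shift v) (h *: v) = f v) ?subrr ?scaler0//.
by rewrite /= -[X in _ + X](scale1r v) -scalerDl hf// -ltrBlDr sub0r.
Qed.

End C1_off0.

Lemma C1_off0_mulmx (R : realType) (n : nat) (H : 'M[R]_n) (f : 'cV[R]_n -> R) :
  H \in unitmx -> C1_off0 f ->
  C1_off0 (fun v => f (H *m v)) /\
  forall v, v != 0 ->
    'd (fun w => f (H *m w)) v = (fun u => 'd f (H *m v) (H *m u)) :> ('cV[R]_n -> R).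
Proof.
move=> uH cf.
have H0 (v : 'cV[R]_n) : v != 0 -> H *m v != 0.
  by apply: contra_neq => Hv0; rewrite -(mulKmx uH v) Hv0 mulmx0.
have cH : continuous (mulmx H : 'cV[R]_n -> 'cV[R]_n) by exact: mulmx_col_continuous.
have dH (v : 'cV[R]_n) : is_diff v (mulmx H) (mulmx H).
  by split; [exact: linear_differentiable|rewrite diff_lin].
have dfH v : v != 0 -> is_diff v (fun w => f (H *m w)) (fun u => 'd f (H *m v) (H *m u)).
  move=> v0; have df := C1_off0_is_diff cf (H0 v v0).
  exact: (is_diff_comp (dH v) df).
split; last by move=> v /dfH[].
apply: (C1_off0_build dfH) => v u v0.
apply: (continuous_comp (f := mulmx H) (g := fun w => 'd f w (H *m u))); first exact: cH.
by have [_] := cf _ (H0 v v0); exact.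
Qed.

Lemma enorm_gt0 (R : realType) (n : nat) (v : 'cV[R]_n) : v != 0 -> 0 < enorm v.
Proof. by move=> v0; rewrite lt_def enorm_ge0 andbT enorm_eq0. Qed.

Definition sqrnorm (R : realType) (n : nat) (v : 'cV[R]_n) : R := \sum_i v i 0 ^+ 2.

Lemma sqrnorm_gt0 (R : realType) (n : nat) (v : 'cV[R]_n) : v != 0 -> 0 < sqrnorm v.
Proof. by move=> v0; rewrite -sqrtr_gt0; exact: enorm_gt0. Qed.

Lemma C1_off0_coord (R : realType) (n : nat) (i : 'I_n) :
  C1_off0 (fun v : 'cV[R]_n => v i 0).
Proof.
have @l : {linear 'cV[R]_n -> R}.
  by exists (fun v : 'cV[R]_n => v i 0); do 2![eexists]; do ?[constructor];
     rewrite ?mxE// => ? *; rewrite ?mxE//; move=> ?; rewrite !mxE.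
have cl : continuous l by exact: coord_continuous.
rewrite -[X in C1_off0 X]/(l : 'cV[R]_n -> R).
apply: (@C1_off0_build _ _ _ (fun _ => l)) => [v _|v u _]; last exact: cst_continuous.
by split; [exact: linear_differentiable|exact: diff_lin].
Qed.

(** These are the coordinates made 0-homogeneous, the building blocks of the test functions that cut
    out boxes on the sphere. *)
Lemma C1_off0_direction (R : realType) (n : nat) (i : 'I_n) :
  C1_off0 (fun v : 'cV[R]_n => (enorm v)^-1 * v i 0).
Proof.
apply: C1_off0M; last exact: C1_off0_coord.
have cS : C1_off0 (@enorm R n).
  apply: (@C1_off0_comp _ _ (@sqrnorm R n) Num.sqrt (fun x => (2 * Num.sqrt x)^-1)).
  - apply: C1_off0_sum => j.
    have := C1_off0M (C1_off0_coord (R := R) j) (C1_off0_coord (R := R) j).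
    by congr C1_off0; apply/funext => v; rewrite expr2.
  - by move=> v v0; apply: is_derive1_sqrt; exact: sqrnorm_gt0.
  move=> v v0; apply: continuousV.
    by rewrite mulf_neq0// gt_eqF// sqrtr_gt0 sqrnorm_gt0.
  by apply: continuousM; [exact: cst_continuous|exact: sqrt_continuous].
by apply: C1_off0V => // v v0; rewrite enorm_eq0.
Qed.

(** * The sphere and the Wasserstein distance *)

Lemma unit_sphere_coord (R : realType) (n : nat) (x : 'cV[R]_n.+1) i :
  unit_sphere R n x -> `|x i 0| <= 1.
Proof.
rewrite /unit_sphere/= /enorm => <-; rewrite -sqrtr_sqr ler_wsqrtr//.
by rewrite (bigD1 i)//= lerDl sumr_ge0// => j _; exact: sqr_ge0.
Qed.

Lemma trmx_continuous (R : realType) (m n : nat) :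
  continuous (@trmx R m n : 'M[R]_(m, n) -> 'M[R]_(n, m)).
Proof.
move=> M; apply: (proj2 (@mx_cvgP _ _ (nbhs M) _ _ _ _ _)) => i j.
rewrite mxE; under eq_fun do rewrite mxE.
exact: coord_continuous.
Qed.

(** Heine-Borel is applied to row vectors and carried over by transposition. *)
Lemma unit_sphere_compact (R : realType) (n : nat) : compact (unit_sphere R n).
Proof.
pose A := [set v : 'rV[R]_n.+1 | unit_sphere R n v^T].
have -> : unit_sphere R n = trmx @` A.
  apply/seteqP; split => [x Sx|_ [v Av <-]//].
  by exists x^T; rewrite /A/= trmxK.
apply: continuous_compact.
  by apply: continuous_subspaceT => v; exact: trmx_continuous.
apply: bounded_closed_compact.
  exists 1; split => // M M1 v Av; apply: (le_trans _ (ltW M1)).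
  apply/mx_norm_leP => // i j; rewrite ord1.
  by have := unit_sphere_coord j Av; rewrite mxE.
rewrite /A /unit_sphere/=.
apply: (@preimage_closed _ _ (fun v : 'rV[R]_n.+1 => enorm v^T) [set x | x = 1]).
  move=> v _; apply: continuous_comp; [exact: trmx_continuous|exact: enorm_continuous].
exact: closed_eq.
Qed.

Lemma sphere_val (R : realType) (n : nat) (x : sphere R n) : unit_sphere R n (val x).
Proof. by have := valP x; rewrite inE. Qed.

Lemma sphere_neq0 (R : realType) (n : nat) (x : sphere R n) : val x != 0.
Proof. by rewrite -enorm_eq0 (sphere_val x) oner_eq0. Qed.

(** The subtype is the image of the compact subset under the extension of its identity map to the
    ambient space, which is continuous on the subspace. *)
Lemma sphere_compact (R : realType) (n : nat) : compact [set: sphere R n].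
Proof.
have c_id : continuous (idfun : sphere R n -> sphere R n) by move=> x; exact: cvg_id.
pose idS : sphere R n -> sphere R n := idfun.
have := (@subspace_valL_continuousP' _ (unit_sphere R n) _ point idS).2 c_id.
move=> /continuous_compact/(_ (@unit_sphere_compact R n)).
congr compact; apply/seteqP; split => // x _.
exists (val x); first exact: sphere_val.
exact: (congr1 (@^~ x) (@valLK _ _ point (unit_sphere R n) idS)).
Qed.

(** A form of the tube lemma: it makes estimates uniform in the point of the sphere. *)
Lemma sphere_near (R : realType) (n : nat) (I : Type) (F : set_system I)
    (P : I -> sphere R n -> Prop) : Filter F ->
  (forall x : sphere R n, \forall x' \near x & i \near F, P i x') ->
  \forall i \near F, forall x, P i x.
Proof.
move=> FF H; have /compact_near_coveringP := @sphere_compact R n.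
move=> /(_ I F P FF (fun x _ => H x)); apply: filterS => i Hi x; exact: Hi.
Qed.

Lemma sphere_continuous_bounded (R : realType) (n : nat) (k : sphere R n -> R) :
  continuous k -> exists2 M : R, 0 <= M & forall x, `|k x| <= M.
Proof.
move=> ck.
have /compact_bounded[M [_ HM]] : compact (k @` [set: sphere R n]).
  apply: continuous_compact; last exact: sphere_compact.
  by apply: continuous_subspaceT.
exists (`|M| + 1) => [|x]; first by rewrite addr_ge0.
by apply: HM; [rewrite ltr_pwDr// ler_norm|exists x].
Qed.

Lemma sphere_continuous_measurable (R : realType) (n : nat) (k : sphere R n -> R) :
  continuous k -> measurable_fun [set: sphere R n] k.
Proof.
move=> ck; apply: (measurability _ (RGenOInfty.measurableE R)) => //.
move=> _ [_ [a ->] <-]; rewrite setTI; apply: open_measurable_sphere.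
by apply: open_comp => [x _|]; [exact: ck|exact: interval_open].
Qed.

Lemma prob_bounded_integrable d (T : measurableType d) (R : realType)
    (P : probability T R) (f : T -> R) (M : R) :
  measurable_fun [set: T] f -> (forall x, `|f x| <= M) ->
  P.-integrable setT (EFin \o f).
Proof.
move=> mf fM; apply: measurable_bounded_integrable => //.
  by apply: (le_lt_trans (probability_le1 P measurableT)); rewrite ltry.
by exists M; split; [exact: num_real|move=> y My x _; apply: le_trans (fM x) (ltW My)].
Qed.

Lemma sphere_continuous_integrable (R : realType) (n : nat) (k : sphere R n -> R)
    (mu : probability (sphere R n) R) :
  continuous k -> mu.-integrable setT (EFin \o k).
Proof.
move=> ck; have [M _ kM] := sphere_continuous_bounded ck.
by apply: prob_bounded_integrable kM; exact: sphere_continuous_measurable.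
Qed.

(** * Couplings, narrow convergence and Lipschitz fields *)

Definition sdist (R : realType) (n : nat) (z : sphere R n * sphere R n) : R :=
  enorm (val z.1 - val z.2).

Lemma sdist_continuous (R : realType) (n : nat) : continuous (@sdist R n).
Proof.
move=> z; pose v1 (z : sphere R n * sphere R n) := val z.1.
pose v2 (z : sphere R n * sphere R n) := val z.2.
apply: (continuous_comp (f := v1 \- v2)); last exact: enorm_continuous.
apply: continuousB.
  by apply: continuous_comp; [exact: cvg_fst|exact: val_sphere_continuous].
by apply: continuous_comp; [exact: cvg_snd|exact: val_sphere_continuous].
Qed.

(** The pair space carries the product of the Borel sigma-algebras, so measurability is obtained
    through the coordinates and not directly from continuity. *)
Lemma sdist_measurable (R : realType) (n : nat) :
  measurable_fun [set: sphere R n * sphere R n] (@sdist R n).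
Proof.
apply: (@measurableT_comp _ _ _ _ _ _ (Num.sqrt : R -> R) _
  (fun z : sphere R n * sphere R n => \sum_i (val z.1 - val z.2) i 0 ^+ 2)).
  by apply: continuous_measurable_fun; exact: sqrt_continuous.
have mc i : measurable_fun [set: sphere R n] (fun x : sphere R n => val x i 0).
  apply: sphere_continuous_measurable => x.
  exact: (continuous_comp (@val_sphere_continuous R n x)
    (@coord_continuous R _ _ i 0 (val x))).
apply: measurable_sum => i; apply: measurable_funX.
under eq_fun do rewrite !mxE.
apply: measurable_funB; first exact: (measurableT_comp (mc i) measurable_fst).
exact: (measurableT_comp (mc i) measurable_snd).
Qed.

Lemma prob_Rintegral_cst d (T : measurableType d) (R : realType) (P : probability T R)
    (c : R) :
  \int[P]_x c = c.
Proof. rewrite Rintegral_cst// -[RHS]mulr1; congr (_ * _).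
exact: (congr1 fine (probability_setT P)). Qed.

Lemma prob_Rintegral_dist d (T : measurableType d) (R : realType) (P : probability T R)
    (f g : T -> R) (e : R) :
  P.-integrable setT (EFin \o f) -> P.-integrable setT (EFin \o g) ->
  (forall x, `|f x - g x| <= e) -> `|\int[P]_x f x - \int[P]_x g x| <= e.
Proof.
move=> If Ig fge; rewrite -RintegralB//.
have Ifg : P.-integrable setT (EFin \o (f \- g)).
  exact: (integrableB measurableT If Ig).
apply: (le_trans (le_normr_Rintegral _ Ifg)) => //.
rewrite -[leRHS](prob_Rintegral_cst P); apply: le_Rintegral => //.
- exact: (integrable_norm Ifg).
- exact: (finite_measure_integrable_cst P e).
- by move=> x _; exact: fge.
Qed.

(* Turns W1-closeness into closeness of integrals of functions that are only continuous. *)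
Lemma sphere_modulus (R : realType) (n : nat) (k : sphere R n -> R) (e : R) :
  continuous k -> 0 < e ->
  exists2 C : R, 0 <= C & forall x y, `|k x - k y| <= e + C * sdist (x, y).
Proof.
move=> ck e0; have [M M0 kM] := sphere_continuous_bounded ck.
have ckk : continuous (fun z : sphere R n * sphere R n => k z.1 - k z.2).
  move=> z; apply: (@continuousB _ _ _ (fun z : sphere R n * sphere R n => k z.1)
    (fun z : sphere R n * sphere R n => k z.2)).
    by apply: continuous_comp; [exact: cvg_fst|exact: ck].
  by apply: continuous_comp; [exact: cvg_snd|exact: ck].
have /compact_near_coveringP := compact_setX (@sphere_compact R n) (@sphere_compact R n).
move=> /(_ R +oo (fun C z => `|k z.1 - k z.2| <= e + C * sdist z) _).
case=> [[x y] _|C [_ HC]]; last first.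
  exists (`|C| + 1) => [|x y]; first by rewrite addr_ge0.
  by apply: (HC (`|C| + 1) _ (x, y)) => //; rewrite ltr_pwDr// ler_norm.
(* Near a diagonal point continuity alone gives a difference below e; away from the diagonal the
   distance is bounded below and a large C takes over. *)
have [xy|xy] := eqVneq x y.
  have : \forall z \near (x, y), `|k z.1 - k z.2| < e.
    subst y; suff : k z.1 - k z.2 @[z --> (x, x)] --> (0 : R).
      by move=> /cvgr0Pnorm_lt; exact.
    by rewrite -(subrr (k x)); exact: (ckk (x, x)).
  move=> H; exists ([set z | `|k z.1 - k z.2| < e], [set C | 0 < C]) => /=.
    by split => //; exists 0; split => //.
  move=> [z C] /= [ke C0]; apply: (le_trans (ltW ke)).
  by rewrite lerDl mulr_ge0 ?enorm_ge0// ltW.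
have d0 : 0 < sdist (x, y).
  rewrite lt_def enorm_ge0 andbT enorm_eq0 subr_eq0.
  by apply: contra_neq xy => /val_inj.
have H : \forall z \near (x, y), sdist (x, y) / 2 < sdist z.
  apply: (cvgr_gt _ (@sdist_continuous R n (x, y))).
  by rewrite ltr_pdivrMr// ltr_pMr// ltr1n.
(* Beyond [4 * M / sdist (x, y)], C times half the distance exceeds [2 * M], which bounds any
   difference of values of k. *)
exists ([set z | sdist (x, y) / 2 < sdist z], [set C | 4 * M / sdist (x, y) < C]) => /=.
  split => //; exists (4 * M / sdist (x, y)); split => //; exact: num_real.
move=> [z C] /= [zd Cd].
have kz : `|k z.1 - k z.2| <= 2 * M.
  by rewrite mulr2n mulrDl mul1r; apply: (le_trans (ler_normB _ _)); apply: lerD.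
apply: (le_trans kz).
have -> : 2 * M = (4 * M / sdist (x, y)) * (sdist (x, y) / 2) by field; rewrite gt_eqF.
apply: (@le_trans _ _ (C * sdist z)); last by rewrite lerDr ltW.
by have dge0 := ltW d0; apply: ler_pM; rewrite ?(ltW Cd) ?(ltW zd) ?divr_ge0 ?mulr_ge0.
Qed.

Lemma same_measure_Rintegral d (T : measurableType d) (R : realType)
    (mu nu : {measure set T -> \bar R}) (f : T -> R) :
  (forall A, measurable A -> mu A = nu A) -> \int[mu]_x f x = \int[nu]_x f x.
Proof. by move=> H; congr fine; apply: eq_measure_integral => A mA _; exact: H. Qed.

Lemma Rintegral_preimage d1 d2 (X : measurableType d1) (Y : measurableType d2)
    (R : realType) (h : X -> Y) (P : probability X R) (Q : probability Y R)
    (f : Y -> R) (M : R) :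
  measurable_fun setT h -> (forall A, measurable A -> Q A = P (h @^-1` A)) ->
  measurable_fun setT f -> (forall y, `|f y| <= M) ->
  \int[Q]_y f y = \int[P]_x f (h x).
Proof.
move=> mh QP mf fM.
pose H : {mfun X >-> Y} := HB.pack h (isMeasurableFun.Build _ _ _ _ _ mh).
transitivity (\int[distribution P H]_y f y).
  by apply: same_measure_Rintegral => A mA; exact: QP.
congr fine; rewrite integral_distribution//; first exact/measurable_EFinP.
have mfh : measurable_fun setT (f \o h) by exact: (measurableT_comp mf mh).
apply: (prob_bounded_integrable P mfh (M := M)) => x; exact: fM.
Qed.

Lemma coupling_Rintegral (R : realType) (n : nat) (mu nu : probability (sphere R n) R) pi
    (k : sphere R n -> R) : coupling mu nu pi -> continuous k ->
  \int[mu]_x k x = \int[pi]_z k z.1 /\ \int[nu]_x k x = \int[pi]_z k z.2.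
Proof.
move=> [pi1 pi2] ck; have mk := sphere_continuous_measurable ck.
have [M _ kM] := sphere_continuous_bounded ck.
split.
  apply: (Rintegral_preimage measurable_fst) mk kM => A mA.
  by rewrite -pi1//; congr (pi _); apply/seteqP; split => [z []|z].
apply: (Rintegral_preimage measurable_snd) mk kM => A mA.
by rewrite -pi2//; congr (pi _); apply/seteqP; split => [z []|z].
Qed.

(** Any coupling whose cost is below the threshold will do: integrating the modulus of k against it
    gives e / 2 plus C times the cost. *)
Lemma W1_narrow_cvg (R : realType) (n : nat) (T : Type) (F : set_system T) {FF : Filter F}
    (mu : T -> probability (sphere R n) R) (nu : probability (sphere R n) R)
    (k : sphere R n -> R) :
  W1 (mu s) nu @[s --> F] --> 0%E -> continuous k ->
  \int[mu s]_x k x @[s --> F] --> \int[nu]_x k x.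
Proof.
move=> /fine_cvgP[Wfin Wcvg] ck; apply/cvgrPdist_le => e e0.
have e2 : 0 < e / 2 by rewrite divr_gt0.
have [C C0 kC] := sphere_modulus ck e2.
(* [C + 1] keeps the denominator positive when C = 0. *)
have C1 : 0 < e / 2 / (C + 1) by rewrite divr_gt0// ltr_pwDr.
have Wlt : \forall s \near F, fine (W1 (mu s) nu) < e / 2 / (C + 1).
  exact: (cvgr_lt _ Wcvg).
apply: filterS2 Wfin Wlt => s sfin slt.
have : (W1 (mu s) nu < (e / 2 / (C + 1))%:E)%E by rewrite -(fineK sfin) lte_fin.
move=> /ereal_inf_lt[_ [pi cpi <-] pilt].
have [-> ->] := coupling_Rintegral cpi ck.
have md : measurable_fun setT (@sdist R n) := @sdist_measurable R n.
have Id : pi.-integrable setT (EFin \o @sdist R n).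
  apply/integrableP; split; first exact/measurable_EFinP.
  apply: (le_lt_trans _ (lt_trans pilt (ltry _))).
  apply: ge0_le_integral => //=.
  - by apply/measurable_EFinP; exact: measurableT_comp.
  - by apply/measurable_EFinP.
  - by move=> z _; rewrite ger0_norm ?enorm_ge0.
have Rd : \int[pi]_z sdist z < e / 2 / (C + 1).
  rewrite -lte_fin /Rintegral fineK//; exact: integrable_fin_num.
have mk := sphere_continuous_measurable ck.
have [M _ kM] := sphere_continuous_bounded ck.
have I1 : pi.-integrable setT (EFin \o (fun z => k z.1)).
  by apply: (@prob_bounded_integrable _ _ _ _ _ M) => //; exact: measurableT_comp.
have I2 : pi.-integrable setT (EFin \o (fun z => k z.2)).
  by apply: (@prob_bounded_integrable _ _ _ _ _ M) => //; exact: measurableT_comp.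
rewrite distrC -RintegralB//.
have I12 : pi.-integrable setT (EFin \o (fun z => k z.1 - k z.2)).
  exact: (integrableB measurableT I1 I2).
apply: (le_trans (le_normr_Rintegral _ I12)) => //.
have Icst : pi.-integrable setT (EFin \o (fun=> e / 2)).
  exact: (finite_measure_integrable_cst pi (e / 2)).
have Icd : pi.-integrable setT (EFin \o (fun z => C * sdist z)).
  exact: (integrableZl measurableT C Id).
have Ied : pi.-integrable setT (EFin \o (fun z => e / 2 + C * sdist z)).
  exact: (integrableD measurableT Icst Icd).
apply: (@le_trans _ _ (\int[pi]_z (e / 2 + C * sdist z))).
  apply: le_Rintegral => //; exact: (integrable_norm I12).
rewrite RintegralD// prob_Rintegral_cst RintegralZl//.
rewrite [leRHS](splitr e) lerD2l.
apply: (@le_trans _ _ (C * (e / 2 / (C + 1)))); first by rewrite ler_wpM2l// ltW.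
rewrite mulrCA ler_piMr ?ltW// ltr_pdivrMr ?ltr_pwDr//; lra.
Qed.

(** The coupling concentrated on the diagonal has zero cost. *)
Lemma W1_same (R : realType) (n : nat) (mu nu : probability (sphere R n) R) :
  same_measure mu nu -> (W1 mu nu <= 0)%E.
Proof.
move=> munu.
have md : measurable_fun setT (fun x : sphere R n => (x, x)).
  exact: measurable_fun_pair.
pose D : {mfun sphere R n >-> (sphere R n * sphere R n)%type} :=
  HB.pack (fun x : sphere R n => (x, x)) (isMeasurableFun.Build _ _ _ _ _ md).
apply: ereal_inf_lbound; exists (distribution mu D).
  split=> A mA.
    rewrite /distribution/= /pushforward.
    by congr (mu _); apply/seteqP; split => [x []|x].
  rewrite -munu// /distribution/= /pushforward.
  by congr (mu _); apply/seteqP; split => [x []|x].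
rewrite ge0_integral_distribution.
- apply: integral0_eq => x _ /=.
  rewrite subrr; apply/eqP; rewrite eqe; apply/eqP.
  by apply/eqP; rewrite enorm_eq0.
- apply/measurable_EFinP; exact: (@sdist_measurable R n).
- by move=> y; rewrite lee_fin enorm_ge0.
Qed.

(** Column j is the image of a unit basis vector; the supremum dominates it because compactness of
    the sphere bounds the set. *)
Lemma le_opnorm (R : realType) (n : nat) (A : 'M[R]_n.+1) i j : `|A i j| <= opnorm A.
Proof.
pose e : 'cV[R]_n.+1 := delta_mx j 0.
have Se : unit_sphere R n e.
  rewrite /unit_sphere/= /enorm (bigD1 j)//= !mxE !eqxx expr1n big1 ?addr0 ?sqrtr1//.
  by move=> k /negbTE kj; rewrite mxE kj expr0n.
apply: (@le_trans _ _ (enorm (A *m e))).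
  rewrite /enorm -sqrtr_sqr ler_wsqrtr// (bigD1 i)//= -colE mxE lerDl.
  by rewrite sumr_ge0// => k _; exact: sqr_ge0.
apply: ub_le_sup; last by exists e.
have /compact_bounded[M [_ HM]] : compact ((fun x => enorm (A *m x)) @` unit_sphere R n).
  apply: continuous_compact; last exact: unit_sphere_compact.
  apply: continuous_subspaceT => x.
  apply: (continuous_comp (f := mulmx A) (g := @enorm R n.+1)).
    exact: mulmx_col_continuous.
  exact: enorm_continuous.
exists (`|M| + 1) => _ [x Sx <-]; apply: le_trans (ler_norm _) _.
by apply: HM; [rewrite ltr_pwDr// ler_norm|exists x].
Qed.

Section lipschitz_field.
Variables (R : realType) (n : nat) (F : probability (sphere R n) R -> 'M[R]_n.+1) (L : R).
Hypothesis L0 : 0 <= L.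
Hypothesis FL : forall mu nu, ((opnorm (F mu - F nu))%:E <= L%:E * W1 mu nu)%E.

(** The argument of [F] is a bundled measure, so invariance under [same_measure] is not automatic;
    it comes from the Lipschitz bound. *)
Lemma lipschitz_same mu nu : same_measure mu nu -> F mu = F nu.
Proof.
move=> munu; apply/eqP; rewrite -subr_eq0; apply/eqP/matrixP => i j; rewrite [RHS]mxE.
apply/eqP; rewrite -normr_le0 -lee_fin.
apply: (@le_trans _ _ (opnorm (F mu - F nu))%:E); first by rewrite lee_fin le_opnorm.
apply: (le_trans (FL mu nu)).
by apply: mule_ge0_le0; rewrite ?lee_fin// W1_same.
Qed.

Lemma lipschitz_cvg (T : Type) (G : set_system T) {FG : Filter G}
    (mu : T -> probability (sphere R n) R) nu :
  W1 (mu s) nu @[s --> G] --> 0%E -> F (mu s) @[s --> G] --> F nu.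
Proof.
move=> /fine_cvgP[Wfin Wcvg]; apply/mx_cvgP => i j.
apply/cvgrPdist_le => e e0.
have e1 : 0 < e / (L + 1) by rewrite divr_gt0// ltr_pwDr.
have Wlt : \forall s \near G, fine (W1 (mu s) nu) < e / (L + 1).
  exact: (cvgr_lt _ Wcvg).
apply: filterS2 Wfin Wlt => s sfin slt; rewrite distrC.
have -> : F (mu s) i j - F nu i j = (F (mu s) - F nu) i j by rewrite !mxE.
apply: (le_trans (le_opnorm _ i j)).
have := FL (mu s) nu; rewrite -(fineK sfin) -EFinM lee_fin => /le_trans; apply.
apply: (@le_trans _ _ (L * (e / (L + 1)))); first by rewrite ler_wpM2l// ltW.
by rewrite mulrCA ler_piMr ?(ltW e0)// ler_pdivrMr ?ltr_pwDr// mul1r lerDl.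
Qed.

End lipschitz_field.

Lemma maxr0_continuous (R : realType) : continuous (fun s : R => Num.max s 0).
Proof.
by move=> s; apply: (continuous_max (f := id) (g := cst 0)); [exact: cvg_id|exact: cvg_cst].
Qed.

Lemma W1_continuous_max (R : realType) (n : nat) (rho : R -> probability (sphere R n) R)
    (t : R) :
  W1_continuous rho -> W1 (rho (Num.max s 0)) (rho (Num.max t 0)) @[s --> t] --> 0%E.
Proof.
move=> /(_ (Num.max t 0)); rewrite le_max lexx orbT => /(_ isT) H.
apply: (cvg_comp (fun s => Num.max s 0) _ _ H).
move=> U /(@maxr0_continuous R t); rewrite !nbhs_simpl /=; apply: filterS => s; apply.
by rewrite /= in_itv/= le_max lexx orbT.
Qed.

(** * Duality with the backward transport equation *)

Lemma diff_sum_delta (R : realType) (n : nat) (f : 'cV[R]_n -> R) (w u : 'cV[R]_n) :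
  'd f w u = \sum_i u i 0 * 'd f w (delta_mx i 0).
Proof.
have {1}-> : u = \sum_i u i 0 *: delta_mx i 0.
  by rewrite {1}(matrix_sum_delta u); apply: eq_bigr => i _; rewrite big_ord1.
by rewrite linear_sum; apply: eq_bigr => i _; rewrite linearZ.
Qed.

Section test_function.
Variables (R : realType) (n : nat) (f : 'cV[R]_n.+1 -> R).
Hypothesis cf : C1_off0 f.
Hypothesis hf : forall a v, 0 < a -> f (a *: v) = f v.

Lemma unitmx_neq0 (B : 'M[R]_n.+1) (v : 'cV[R]_n.+1) :
  B \in unitmx -> v != 0 -> B *m v != 0.
Proof. by move=> uB; apply: contra_neq => Bv0; rewrite -(mulKmx uB v) Bv0 mulmx0. Qed.

Lemma C1_off0_sphere_continuous (B : 'M[R]_n.+1) : B \in unitmx ->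
  continuous (fun x : sphere R n => f (B *m val x)).
Proof.
move=> uB x; have [cB _] := C1_off0_mulmx uB cf.
exact: (continuous_comp (@val_sphere_continuous R n x)
  (C1_off0_continuous cB (sphere_neq0 x))).
Qed.

(** [C1_off0] provides continuity in the base point for each fixed direction; expanding the
    direction in the canonical basis makes it joint. *)
Lemma diff_cvg (T : Type) (G : set_system T) {FG : Filter G}
    (w u : T -> 'cV[R]_n.+1) (w0 u0 : 'cV[R]_n.+1) :
  w0 != 0 -> w @ G --> w0 -> u @ G --> u0 -> 'd f (w s) (u s) @[s --> G] --> 'd f w0 u0.
Proof.
move=> w00 ww0 uu0.
have [_ cD] := cf w00; have DE := diff_sum_delta f.
pose D w u : R := 'd f w u.
change (D (w s) (u s) @[s --> G] --> D w0 u0).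
change (forall u, {for w0, continuous (D^~ u)}) in cD.
change (forall w u, D w u = \sum_i u i 0 * D w (delta_mx i 0)) in DE.
clearbody D; rewrite DE; under eq_fun do rewrite DE.
apply: cvg_big => [x|i _]; first exact: add_continuous.
apply: cvgM; last exact: (cvg_comp _ _ ww0 (cD (delta_mx i 0))).
by have /mx_cvgP := uu0; exact.
Qed.

Lemma radial_ext_mulmx (B : 'M[R]_n.+1) v : v != 0 ->
  f (B *m v) = radial_ext (fun x : sphere R n => f (B *m val x)) v.
Proof.
move=> v0; rewrite /radial_ext val_normalize// -scalemxAr hf// invr_gt0.
exact: enorm_gt0.
Qed.

Lemma test_C1_sphere (B : 'M[R]_n.+1) : B \in unitmx ->
  C1_sphere (fun x : sphere R n => f (B *m val x)).
Proof.
move=> uB v v0; have [cB _] := C1_off0_mulmx uB cf.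
have [crad _] := C1_off0_eq cB (@radial_ext_mulmx B).
have [dr cdr] := crad v v0; split => // i.
exact: C1_off0_derive_continuous.
Qed.

(* By Euler's identity the radial part of the drift pairs to zero with the gradient of a
   0-homogeneous function. *)
Lemma test_drift (F : probability (sphere R n) R -> 'M[R]_n.+1) (B : 'M[R]_n.+1) x mu :
  B \in unitmx ->
  ((sgrad (fun x : sphere R n => f (B *m val x)) x)^T *m drift F x mu) 0 0 =
  'd f (B *m val x) (B *m (F mu *m val x)).
Proof.
move=> uB; have [cB dB] := C1_off0_mulmx uB cf.
have [crad drad] := C1_off0_eq cB (@radial_ext_mulmx B).
have x0 := sphere_neq0 x.
have gE u : ((sgrad (fun x : sphere R n => f (B *m val x)) x)^T *m u) 0 0 =
    'd (fun w => f (B *m w)) (val x) u.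
  rewrite mxE; apply: etrans (esym (diff_sum_delta _ _ u)); apply: eq_bigr => i _.
  by rewrite !mxE mulrC deriveE ?drad//; have [] := crad _ x0.
rewrite gE /drift.
have -> : (1%:M - val x *m (val x)^T) *m F mu *m val x =
    F mu *m val x - ((val x)^T *m F mu *m val x) 0 0 *: val x.
  rewrite !mulmxBl mul1mx -!mulmxA; congr (_ - _).
  by rewrite [X in val x *m X]mx11_scalar mul_mx_scalar.
have eul : 'd (fun w => f (B *m w)) (val x) (val x) = 0.
  apply: (homogeneous_euler x0 cB) => a w a0; by rewrite -scalemxAr hf.
apply: etrans (diffBZ _ _ _ _ _) _.
apply: etrans (congr1 (fun z => _ - _ * z) eul) _.
apply: etrans (congr1 (fun z => _ - z) (mulr0 _)) _.
apply: etrans (subr0 _) _.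
exact: (congr1 (@^~ (F mu *m val x)) (dB _ x0)).
Qed.

Lemma is_derive_test_curve (H : R -> 'M[R]_n.+1) (H' : 'M[R]_n.+1) (t : R)
    (x : 'cV[R]_n.+1) :
  is_derive t 1 H H' -> H t *m x != 0 ->
  is_derive t 1 (fun s => f (H s *m x)) ('d f (H t *m x) (H' *m x)).
Proof.
move=> dH Hx0; have [df _] := cf Hx0.
have dx := is_derive_mulmx dH (is_derive_cst x t 1).
rewrite mulmx0 addr0 in dx; have [dc ec] := dx.
have diffc : differentiable (fun s => H s *m x) t by apply/derivable1_diffP.
have dfc := differentiable_comp diffc df.
split; first exact/derivable1_diffP.
rewrite deriveE// diff_comp//=.
congr ('d f _ _); apply: etrans _ ec.
exact: (esym (deriveE (1 : R) diffc)).
Qed.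

End test_function.

Lemma Rintegral_sum d (T : measurableType d) (R : realType) (P : probability T R)
    (I : Type) (r : seq I) (c : I -> R) (k : I -> T -> R) :
  (forall i, P.-integrable setT (EFin \o k i)) ->
  \int[P]_x (\sum_(i <- r) c i * k i x) = \sum_(i <- r) c i * \int[P]_x k i x.
Proof.
move=> Ik.
suff [_ ->] : P.-integrable setT (EFin \o (fun x => \sum_(i <- r) c i * k i x)) /\
  \int[P]_x (\sum_(i <- r) c i * k i x) = \sum_(i <- r) c i * \int[P]_x k i x by [].
elim: r => [|i r [Ir IH]].
  rewrite big_nil; under eq_fun do rewrite big_nil.
  split; last exact: prob_Rintegral_cst.
  exact: (finite_measure_integrable_cst P 0).
have Ii : P.-integrable setT (EFin \o (fun x => c i * k i x)).
  exact: (integrableZl measurableT (c i) (Ik i)).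
rewrite big_cons; under eq_fun do rewrite big_cons.
rewrite -IH -RintegralZl// -RintegralD//; split => //.
exact: (integrableD measurableT Ii Ir).
Qed.

Lemma is_derive_cvg (R : realType) (V : normedModType R) (f : R -> V) (t : R) (df : V) :
  h^-1 *: (f (h + t) - f t) @[h --> (0 : R)^'] --> df <-> is_derive t 1 f df.
Proof.
have E : (fun h : R => h^-1 *: (f (h + t) - f t)) =
    (fun h : R => h^-1 *: ((f \o shift t) (h *: 1) - f t)).
  by apply/funext => h; rewrite /= [h *: 1]mulr1.
rewrite E; split=> [H|[H <-]]; last exact: H.
split; last exact/cvg_lim.
by apply/cvg_ex; exists df.
Qed.

(* [phi s] is a solution of the backward transport equation along the curve [mu], and
   [kap s B] is the derivative of [phi s] along the linear field [B]. *)
Section duality.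
Variables (R : realType) (n : nat) (mu : R -> probability (sphere R n) R).
Variables (A : R -> 'M[R]_n.+1) (phi : R -> sphere R n -> R).
Variable kap : R -> 'M[R]_n.+1 -> sphere R n -> R.
Hypothesis cA : continuous A.
Hypothesis narrow : forall k : sphere R n -> R, continuous k ->
  continuous (fun r => \int[mu r]_x k x).
Hypothesis phi_continuous : forall s, continuous (phi s).
Hypothesis kap_continuous : forall s B, continuous (kap s B).
Hypothesis kap_jointly : forall x s,
  kap p.2 (A p.2) p.1 @[p --> (x, s)] --> kap s (A s) x.
Hypothesis kap_linear : forall s B x,
  kap s B x = \sum_(ij : 'I_n.+1 * 'I_n.+1) B ij.1 ij.2 * kap s (delta_mx ij.1 ij.2) x.
Hypothesis phi_derive : forall (s : R) x,
  is_derive s 1 (fun t => phi t x) (- kap s (A s) x).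
Hypothesis weak : forall s t, 0 <= t ->
  \int[mu t]_x phi s x - \int[mu 0]_x phi s x =
  \int[lebesgue_measure]_(r in `[0, t]) \int[mu r]_x kap s (A r) x.

Let g s r := \int[mu r]_x kap s (A r) x.

(** Linearity of [kap] in the matrix separates the two sources of time dependence: the entries of A,
    which are continuous, and integrals of finitely many fixed functions, to which narrow continuity
    applies. *)
Let g_continuous s : continuous (g s).
Proof.
have -> : g s = fun r => \sum_(ij : 'I_n.+1 * 'I_n.+1)
    A r ij.1 ij.2 * \int[mu r]_x kap s (delta_mx ij.1 ij.2) x.
  apply/funext => r; rewrite /g -Rintegral_sum; last first.
    by move=> ij; apply: sphere_continuous_integrable; exact: kap_continuous.
  by apply: eq_Rintegral => x _; exact: kap_linear.
move=> r; apply: cvg_big => [x|ij _]; first exact: add_continuous.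
apply: cvgM; first by have /mx_cvgP := @cA r; exact.
exact: (narrow (@kap_continuous s (delta_mx ij.1 ij.2))).
Qed.

Let u s t := \int[mu t]_x phi s x.

(** The weak formulation writes the increment as the integral of the continuous function [g s]. It
    concerns nonnegative times only, so a two-sided derivative requires t > 0. *)
Let u_derive s (t : R) : 0 < t -> is_derive t 1 (u s) (g s t).
Proof.
move=> t0; have [Q [Q0 dQ]] := antiderivative (@g_continuous s).
have uE r : 0 < r -> u s 0 + Q r = u s r.
  move=> r0; have := weak s (ltW r0); rewrite -/(u s 0) -/(u s r).
  suff -> : \int[lebesgue_measure]_(r in `[0, r]) \int[mu r]_x kap s (A r) x = Q r.
    by move=> <-; rewrite addrC subrK.
  have cQ : continuous Q by move=> x; exact: (is_derive_continuous (dQ x)).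
  rewrite /Rintegral (@continuous_FTC2 _ (g s) Q _ _ r0)/= ?Q0 ?subr0//.
  - by apply: continuous_subspaceT; exact: g_continuous.
  - split; first by move=> x _; have [] := dQ x.
    + by apply: cvg_at_right_filter; exact: cQ.
    + by apply: cvg_at_left_filter; exact: cQ.
  - by move=> x _; rewrite derive1E; have [] := dQ x.
apply: (@near_eq_is_derive _ _ _ (fun r => u s 0 + Q r)).
  have : \forall r \near t, 0 < r by exact: (cvgr_gt _ (@cvg_id _ (nbhs t)) _ t0).
  by apply: filterS => r /uE.
rewrite -[g s t]add0r; apply: is_deriveD.
Qed.

(** The mean value theorem for the remainder [q] reduces the estimate to closeness of [kap] at
    neighbouring times, which is uniform in x by compactness. *)
Let phi_taylor s e : 0 < e -> \forall t \near s, forall x,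
  `|phi t x - phi s x + (t - s) * kap s (A s) x| <= e * `|t - s|.
Proof.
move=> e0.
have H : \forall t \near s, forall x, `|kap s (A s) x - kap t (A t) x| <= e.
  apply: (@sphere_near _ _ _ (nbhs s)
    (fun t x => `|kap s (A s) x - kap t (A t) x| <= e)) => x.
  have H1 : kap s (A s) p.1 - kap p.2 (A p.2) p.1 @[p --> (x, s)] --> (0 : R).
    rewrite -(subrr (kap s (A s) x)); apply: cvgB; last exact: kap_jointly.
    apply: (@continuous_comp _ _ _ (@fst (sphere R n) R) (kap s (A s)) (x, s)).
      exact: cvg_fst.
    exact: kap_continuous.
  by have /cvgr0Pnorm_le := H1; exact.
have /nbhs_ballP[d /= d0 Hd] := H; apply/nbhs_ballP; exists d => //= t std x.
pose q r := phi r x - phi s x + (r - s) * kap s (A s) x.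
have dq (r : R) : is_derive r 1 q (- kap r (A r) x + kap s (A s) x).
  have H1 : is_derive r 1 (fun r => phi r x - phi s x) (- kap r (A r) x - 0).
    exact: is_deriveB.
  have H2 : is_derive r 1 (fun r => r - s) (1 - 0) by apply: is_deriveB.
  have H3 := is_deriveD H1 (is_deriveM H2 (is_derive_cst (kap s (A s) x) r 1)).
  apply: (is_derive_ext H3) => //=.
  by rewrite !subr0 scaler0 add0r /GRing.scale/= mulr1.
have q0 : q s = 0 by rewrite /q !subrr mul0r addr0.
suff [c sc qE] : exists2 c, `|s - c| < d &
    q t - q s = (- kap c (A c) x + kap s (A s) x) * (t - s).
  rewrite -[X in `|X|]subr0 -q0 qE normrM ler_wpM2r// addrC; exact: Hd.
have cq a b : {within `[a, b], continuous q}.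
  by apply: derivable_within_continuous => r _; have [] := dq r.
have [ts|ts|<-] := ltgtP t s.
- have [c] := MVT ts (fun r _ => dq r) (cq _ _).
  rewrite in_itv/= => /andP[tc cs] qE; exists c.
    move: std; rewrite /ball/= !gtr0_norm ?subr_gt0//; lra.
  by rewrite -[LHS]opprB qE -mulrN opprB.
- have [c] := MVT ts (fun r _ => dq r) (cq _ _).
  rewrite in_itv/= => /andP[tc cs] qE; exists c => //.
  move: std; rewrite /ball/= !ltr0_norm ?subr_lt0//; lra.
- by exists t; rewrite ?subrr ?normr0 ?mulr0.
Qed.

Let h t := \int[mu t]_x phi t x.
Let w s t := \int[mu t]_x (phi t x - phi s x).

(** In [u] the test function is frozen at time s and only the measure moves; [w] records the change
    of the test function. *)
Let hE s t : h t = u s t + w s t.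
Proof.
have cp r : (mu t).-integrable setT (EFin \o phi r).
  by apply: sphere_continuous_integrable; exact: phi_continuous.
have wE : w s t = h t - u s t := RintegralB measurableT (cp t) (cp s).
by rewrite wE addrC subrK.
Qed.

(** The Taylor estimate is uniform in x, hence survives integration against the moving measure;
    replacing that measure by the one at time s then costs only narrow continuity. *)
Let w_derive (s : R) : is_derive s 1 (w s) (- g s s).
Proof.
apply/is_derive_cvg.
have ws : w s s = 0.
  by rewrite /w; under eq_Rintegral do rewrite subrr; exact: prob_Rintegral_cst.
rewrite ws; apply/cvgrPdist_le => e e0.
have e2 : 0 < e / 2 by rewrite divr_gt0.
have sh : (fun r : R => r + s) @ (0 : R)^' --> s.
  apply: cvg_within_filter.
  suff : r + s @[r --> (0 : R)] --> 0 + s by rewrite add0r.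
  by apply: cvgD; [exact: cvg_id|exact: cvg_cst].
have H1 : \forall r \near (0 : R)^', forall x,
    `|phi (r + s) x - phi s x + (r + s - s) * kap s (A s) x| <= e / 2 * `|r + s - s|.
  exact: (sh _ (phi_taylor s e2)).
have H2 : \forall r \near (0 : R)^', `|g s s - \int[mu (r + s)]_x kap s (A s) x| <= e / 2.
  have cg : \int[mu r]_x kap s (A s) x @[r --> s] --> g s s.
    exact: (narrow (@kap_continuous s (A s))).
  by have /cvgrPdist_le := cvg_comp _ _ sh cg; exact.
have H3 : \forall r \near (0 : R)^', r != 0 :> R by exact: nbhs_dnbhs_neq.
apply: filterS3 H1 H2 H3 => r /= H1 H2 r0.
have ck : (mu (r + s)).-integrable setT (EFin \o kap s (A s)).
  by apply: sphere_continuous_integrable; exact: kap_continuous.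
have cp t : (mu (r + s)).-integrable setT (EFin \o phi t).
  by apply: sphere_continuous_integrable; exact: phi_continuous.
have cpp : (mu (r + s)).-integrable setT (EFin \o (fun x => phi (r + s) x - phi s x)).
  exact: (integrableB measurableT (cp (r + s)) (cp s)).
have crk : (mu (r + s)).-integrable setT (EFin \o (fun x => - r * kap s (A s) x)).
  exact: (integrableZl measurableT (- r) ck).
have H4 : `|w s (r + s) + r * \int[mu (r + s)]_x kap s (A s) x| <= e / 2 * `|r|.
  rewrite -[_ * _]opprK -mulNr -RintegralZl//.
  apply: prob_Rintegral_dist => // x.
  by have := H1 x; rewrite addrK mulNr opprK.
rewrite subr0 /GRing.scale/=.
have -> : - g s s - r^-1 * w s (r + s) =
    - (g s s - \int[mu (r + s)]_x kap s (A s) x) -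
    r^-1 * (w s (r + s) + r * \int[mu (r + s)]_x kap s (A s) x) by field.
rewrite [leRHS](splitr e); apply: (le_trans (ler_normB _ _)); apply: lerD.
  by rewrite normrN.
by rewrite normrM normfV mulrC ler_pdivrMr ?normr_gt0.
Qed.

(** At an interior time s the derivatives of [u s] and [w s] are opposite. Continuity of [h] up to
    the endpoints lets the mean value theorem reach time 0. *)
Lemma duality t : 0 <= t -> h t = h 0.
Proof.
have hs s : h = (fun t => u s t + w s t) by apply/funext => r; exact: hE.
have ch : continuous h.
  move=> s; rewrite (hs s); apply: cvgD; last exact: (is_derive_continuous (w_derive s)).
  exact: (narrow (@phi_continuous s)).
have dh (s : R) : s \in `]0, t[ -> is_derive s 1 h 0.
  rewrite in_itv/= => /andP[s0 _]; rewrite (hs s) -(subrr (g s s)).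
  by apply: is_deriveD; [exact: u_derive|exact: w_derive].
move=> t0; have [c _] := MVT_segment t0 dh (continuous_subspaceT ch).
by rewrite mul0r => /eqP; rewrite subr_eq0 => /eqP.
Qed.

End duality.

(** * Determination of a measure by test functions *)

(** The powers converge pointwise to the indicator of p = 1 and are dominated by 1. *)
Lemma prob_moments_cvg d (T : measurableType d) (R : realType) (P : probability T R)
    (p : T -> R) :
  measurable_fun setT p -> (forall x, 0 <= p x <= 1) ->
  \int[P]_x (p x ^+ k) @[k --> \oo] --> fine (P [set x | p x = 1]).
Proof.
move=> mp p01.
have m1 : measurable [set x | p x = 1].
  have := mp measurableT _ (measurable_set1 (1 : R)).
  by rewrite setTI; congr measurable.
have mf k : measurable_fun setT (fun x => (p x ^+ k)%:E).
  by apply/measurable_EFinP; exact: measurable_funX.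
have mind : measurable_fun setT (fun x => (\1_[set x | p x = 1] x)%:E : \bar R).
  by apply/measurable_EFinP; exact: measurable_indic.
have lim : {ae P, forall x, setT x ->
    (p x ^+ k)%:E @[k --> \oo] --> (\1_[set x | p x = 1] x)%:E}.
  apply: aeW => x _; apply: cvg_EFin; first exact: nearW.
  have [p1|p1] := eqVneq (p x) 1.
    rewrite /= indicE mem_set// p1; under eq_fun do rewrite expr1n.
    exact: cvg_cst.
  rewrite /= indicE memNset; last by move/eqP: p1.
  apply: cvg_expr; have /andP[p0 p1'] := p01 x.
  by rewrite ger0_norm// lt_neqAle p1.
have dom : {ae P, forall x k, setT x -> (`|(p x ^+ k)%:E| <= cst 1%:E x)%E}.
  apply: aeW => x k _; have /andP[p0 p1] := p01 x.
  by rewrite gee0_abs lee_fin ?exprn_ge0// exprn_ile1.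
have [_ _ H] := dominated_convergence measurableT mf mind lim
  (finite_measure_integrable_cst P 1 measurableT) dom.
have e1 : (\int[P]_x (\1_[set x | p x = 1] x)%:E)%E = P [set x | p x = 1].
  by rewrite integral_indic// setIT.
rewrite e1 in H; apply: fine_cvg; rewrite fineK; first exact: H.
exact: fin_num_measure.
Qed.

Lemma prob_eq_moments d1 d2 (T1 : measurableType d1) (T2 : measurableType d2)
    (R : realType) (P : probability T1 R) (Q : probability T2 R) (p : T1 -> R) (q : T2 -> R) :
  measurable_fun setT p -> (forall x, 0 <= p x <= 1) ->
  measurable_fun setT q -> (forall x, 0 <= q x <= 1) ->
  (forall k, \int[P]_x (p x ^+ k) = \int[Q]_x (q x ^+ k)) ->
  P [set x | p x = 1] = Q [set x | q x = 1].
Proof.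
move=> mp p01 mq q01 pq.
have hp := prob_moments_cvg (P := P) mp p01.
have hq := prob_moments_cvg (P := Q) mq q01.
have m1 : measurable [set x | p x = 1].
  have := mp measurableT _ (measurable_set1 (1 : R)).
  by rewrite setTI; congr measurable.
have m2 : measurable [set x | q x = 1].
  have := mq measurableT _ (measurable_set1 (1 : R)).
  by rewrite setTI; congr measurable.
rewrite -[LHS]fineK ?fin_num_measure// -[RHS]fineK ?fin_num_measure//; congr (_%:E).
apply: (cvg_unique _ hp) => //.
have -> : (fun k => \int[P]_x (p x ^+ k)) = fun k => \int[Q]_x (q x ^+ k) by apply/funext.
exact: hq.
Qed.

(** The function is max(s, 0)^2 / 2, a continuously differentiable substitute for the positive
    part. *)
Lemma C1_bump (R : realType) : exists b : R -> R, [/\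
  forall s : R, is_derive s 1 b (Num.max s 0),
  forall s, 0 <= b s &
  forall s, (0 < b s) = (0 < s)].
Proof.
have [b [b0 db]] := antiderivative (@maxr0_continuous R).
have cb u v : {within `[u, v], continuous b}.
  by apply: derivable_within_continuous => r _; have [] := db r.
have bN s : s <= 0 -> b s = 0.
  rewrite le_eqVlt => /predU1P[->//|s0].
  have [c] := MVT s0 (fun r _ => db r) (cb _ _).
  rewrite in_itv/= => /andP[_ c0]; rewrite b0 max_r ?mul0r ?(ltW c0)//; lra.
have bP s : 0 < s -> 0 < b s.
  move=> s0; have [c] := MVT s0 (fun r _ => db r) (cb _ _).
  rewrite in_itv/= => /andP[c0 _]; rewrite b0 !subr0 => ->.
  by rewrite mulr_gt0// lt_max c0.
exists b; split => // s; have [s0|s0] := ltP 0 s.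
- exact: ltW (bP _ s0).
- by rewrite bN.
- by rewrite bP.
- by rewrite bN// ltxx.
Qed.

Section cone_sets.
Variables (R : realType) (n : nat).

(* A pi-system of open sets whose indicators are limits of admissible test functions:
   (1 + f)^-k tends to the indicator of [f = 0]. *)
Definition cone_sets : set (set (sphere R n)) := [set B | exists f : 'cV[R]_n.+1 -> R,
  [/\ C1_off0 f, forall a v, 0 < a -> f (a *: v) = f v, forall v, 0 <= f v &
      B = [set x | 0 < f (val x)]]].

Lemma cone_sets_setI : setI_closed cone_sets.
Proof.
move=> _ _ [f [cf hf f0 ->]] [g [cg hg g0 ->]].
exists (f * g); split.
- exact: C1_off0M.
- by move=> a v a0; rewrite /GRing.mul/= hf ?hg.
- by move=> v; exact: mulr_ge0.
apply/seteqP; split => [x /= [fx gx]|x /=]; first exact: mulr_gt0.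
rewrite /GRing.mul/= => fg.
split; rewrite lt_neqAle ?f0 ?g0 andbT eq_sym; apply: contraTneq fg => ->.
  by rewrite mul0r ltxx.
by rewrite mulr0 ltxx.
Qed.

Lemma cone_setsT : cone_sets setT.
Proof.
exists (fun=> 1); split => //; first exact: C1_off0_cst.
by apply/seteqP; split => x //= _; exact: ltr01.
Qed.

(** The test function is a product of bumps, two per normalised coordinate, and is positive exactly
    when all the inequalities hold; on the sphere the normalisation disappears. *)
Lemma cone_sets_box (a b : 'I_n.+1 -> R) :
  cone_sets [set x : sphere R n | forall i, a i < val x i 0 < b i].
Proof.
have [th [dth th0 thP]] := C1_bump R.
have dir (v : 'cV[R]_n.+1) c i : 0 < c ->
    (enorm (c *: v))^-1 * (c *: v) i 0 = (enorm v)^-1 * v i 0.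
  move=> c0; rewrite enormZ mxE gtr0_norm// invfM mulrACA mulVf ?mul1r//.
  by rewrite gt_eqF.
pose p i (v : 'cV[R]_n.+1) := (enorm v)^-1 * v i 0.
exists (fun v => \prod_i (th (p i v - a i) * th (b i - p i v))); split.
- apply: C1_off0_prod => i; apply: C1_off0M.
    apply: (@C1_off0_comp _ _ (fun v => p i v - a i) th (fun s => Num.max s 0)).
    + exact: (C1_off0D (C1_off0_direction i) (C1_off0_cst (- a i))).
    + by move=> v _; exact: maxr0_continuous.
  apply: (@C1_off0_comp _ _ (fun v => b i - p i v) th (fun s => Num.max s 0)).
  + have := C1_off0D (C1_off0_cst (b i))
      (C1_off0M (C1_off0_cst (- 1)) (C1_off0_direction (R := R) i)).
    by congr C1_off0; apply/funext => v; rewrite /GRing.add/= /GRing.mul/= mulN1r.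
  + by move=> v _; exact: maxr0_continuous.
- by move=> c v c0; apply: eq_bigr => i _; rewrite /p dir.
- by move=> v; apply: prodr_ge0 => i _; apply: mulr_ge0.
have pE (x : sphere R n) i : p i (val x) = val x i 0.
  by rewrite /p (sphere_val x) invr1 mul1r.
apply/seteqP; split => x /=.
  move=> H; apply: prodr_gt0 => i _; have /andP[h1 h2] := H i.
  by rewrite pE mulr_gt0// thP subr_gt0.
move=> H i; have : th (p i (val x) - a i) * th (b i - p i (val x)) != 0.
  have : \prod_i (th (p i (val x) - a i) * th (b i - p i (val x))) != 0 by rewrite gt_eqF.
  by move=> /prodf_neq0; apply.
rewrite mulf_eq0 negb_or pE => /andP[h1 h2].
by apply/andP; split; rewrite -subr_gt0 -thP lt_neqAle th0 andbT eq_sym.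
Qed.

(** Every open subset of the sphere is a countable union of traces of rational boxes. *)
Lemma cone_sets_generate : @measurable _ (sphere R n) = <<s cone_sets >>.
Proof.
apply/seteqP; split; last first.
  apply: smallest_sub; first exact: sigma_algebra_measurable.
  move=> _ [f [cf hf f0 ->]]; apply: open_measurable_sphere.
  apply: (@open_comp _ _ (fun x : sphere R n => f (val x)) [set y | 0 < y]); last first.
    exact: open_gt.
  move=> x _; have := C1_off0_sphere_continuous cf (unitmx1 R n.+1) (x := x).
  by under eq_fun do rewrite mul1mx.
apply: smallest_sub; first exact: smallest_sigma_algebra.
move=> _ [V oV <-].
pose box (q : {ffun 'I_n.+1 -> rat * rat}) : set (sphere R n) :=
  [set x : sphere R n | forall i, ratr (q i).1 < val x i 0 < ratr (q i).2].
(* Boxes that leave [V] are replaced by the empty set, so that the union runs over a whole countable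
   type. *)
pose boxV q := if pselect (box q `<=` set_val @^-1` V) then box q else set0.
have -> : set_val @^-1` V = \bigcup_q boxV q.
  rewrite /boxV.
  apply/seteqP; split => [x /= Vx|x [q _]]; last by case: pselect => // qV /qV.
  have /nbhs_ballP[e /= e0 xe] : nbhs (val x) V by apply: open_nbhs_nbhs.
  have H i : exists q : rat * rat, val x i 0 - e < ratr q.1 < val x i 0 /\
      val x i 0 < ratr q.2 < val x i 0 + e.
    have /rat_in_itvoo[a] : val x i 0 - e < val x i 0 by rewrite ltrBlDr ltrDl.
    have /rat_in_itvoo[b] : val x i 0 < val x i 0 + e by rewrite ltrDl.
    by rewrite !in_itv/= => hb ha; exists (a, b).
  have [q Hq] := choice H; exists (finfun q) => //.
  case: pselect => [_ i|[]].
    by rewrite ffunE; have [/andP[_ ->] /andP[-> _]] := Hq i.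
  move=> y Hy; apply: xe; rewrite -ball_normE/=.
  apply: (@le_lt_trans _ _ (\big[Num.max/0]_i `|val x i 0 - val y i 0|)).
    apply/mx_norm_leP; first exact: bigmax_ge_id.
    move=> i j; rewrite ord1 !mxE.
    exact: (le_bigmax _ (fun i => `|val x i 0 - val y i 0|)).
  apply/bigmax_ltP; split => // i _.
  have := Hy i; rewrite ffunE; have [/andP[h1 h2] /andP[h3 h4]] := Hq i.
  move=> /andP[h5 h6]; rewrite ltr_norml; apply/andP; split; lra.
suff : @measurable _ (g_sigma_algebraType cone_sets) (\bigcup_q boxV q) by [].
apply: countable_bigcupT_measurable => // q; rewrite /boxV.
case: pselect => /= qV; last exact: measurable0.
by apply: sub_sigma_algebra; exact: cone_sets_box.
Qed.

Lemma cone_sets_unique (mu nu : probability (sphere R n) R) :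
  (forall B, cone_sets B -> mu B = nu B) -> same_measure mu nu.
Proof.
move=> H A mA; apply: (measure_unique cone_sets (fun=> setT)) => //.
- exact: cone_sets_generate.
- exact: cone_sets_setI.
- by move=> _; exact: cone_setsT.
- by apply/seteqP; split => // x _; exists 0%N.
- by move=> _; apply: (le_lt_trans (probability_le1 mu measurableT)); rewrite ltry.
Qed.

End cone_sets.

(* The curve is extended to negative times by its value at 0, so that every derivative in
   time is two-sided. *)
Lemma weak_solution_conserved (R : realType) (n : nat)
    (F : probability (sphere R n) R -> 'M[R]_n.+1) (rho0 : probability (sphere R n) R)
    (rho : R -> probability (sphere R n) R) (H : R -> 'M[R]_n.+1)
    (f : 'cV[R]_n.+1 -> R) (t : R) :
  weak_solution F rho0 rho ->
  continuous (fun s : R => F (rho (Num.max s 0))) ->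
  H 0 = 1%:M -> (forall s, H s \in unitmx) ->
  (forall s : R, is_derive s 1 H (- (H s *m F (rho (Num.max s 0))))) ->
  C1_off0 f -> (forall a v, 0 < a -> f (a *: v) = f v) -> 0 <= t ->
  \int[rho t]_x f (H t *m val x) = \int[rho0]_x f (val x).
Proof.
move=> [rho_cont rho_0 rho_weak] cA H0 uH dH cf hf t0.
pose phi s (x : sphere R n) := f (H s *m val x).
pose kap s (B : 'M[R]_n.+1) (x : sphere R n) : R :=
  'd f (H s *m val x) (H s *m (B *m val x)).
have cH : continuous H by move=> s; exact: (is_derive_continuous (dH s)).
(* Joint continuity in matrix, field and point, stated for an arbitrary filter because it serves
   both for x alone and for the pair (x, s). *)
have kapw (T : Type) (G : set_system T) (FG : Filter G) (h b : T -> 'M[R]_n.+1)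
    (y : T -> sphere R n) (h0 b0 : 'M[R]_n.+1) (y0 : sphere R n) :
    h0 \in unitmx -> h @ G --> h0 -> b @ G --> b0 -> y @ G --> y0 ->
    'd f (h p *m val (y p)) (h p *m (b p *m val (y p))) @[p --> G] -->
    ('d f (h0 *m val y0) (h0 *m (b0 *m val y0)) : R).
  move=> uh0 hh0 bb0 yy0.
  have vy : val (y p) @[p --> G] --> val y0.
    exact: (cvg_comp _ _ yy0 (@val_sphere_continuous R n y0)).
  apply: (diff_cvg cf).
  - exact: unitmx_neq0 (sphere_neq0 y0).
  - exact: mulmx_cvg.
  - by apply: mulmx_cvg => //; exact: mulmx_cvg.
suff E : \int[rho (Num.max t 0)]_x phi t x = \int[rho (Num.max 0 0)]_x phi 0 x.
  move: E; rewrite /phi H0 max_l// maxxx => ->.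
  by rewrite (same_measure_Rintegral _ rho_0); apply: eq_Rintegral => x _; rewrite mul1mx.
apply: (@duality R n (fun s => rho (Num.max s 0)) (fun s => F (rho (Num.max s 0)))
  phi kap) => //.
- move=> k ck s; apply: W1_narrow_cvg => //; exact: W1_continuous_max.
- by move=> s; exact: C1_off0_sphere_continuous.
- move=> s B x.
  exact: (kapw _ (nbhs x) _ (cst (H s)) (cst B) id _ _ _ (uH s) (cvg_cst _)
    (cvg_cst _) cvg_id).
- move=> x s; apply: (kapw _ _ _ (H \o snd) (fun p => F (rho (Num.max p.2 0))) fst) => //.
  + by apply: (cvg_comp _ _ cvg_snd); exact: cH.
  + by apply: (cvg_comp snd (fun r => F (rho (Num.max r 0))) cvg_snd); exact: cA.
  + exact: cvg_fst.
- move=> s B x.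
  have Bx : B *m val x = \sum_(ij : 'I_n.+1 * 'I_n.+1)
      B ij.1 ij.2 *: (delta_mx ij.1 ij.2 *m val x).
    rewrite {1}(matrix_sum_delta B) pair_bigA/= mulmx_suml.
    by apply: eq_bigr => ij _; rewrite scalemxAl.
  apply: etrans (congr1 (fun z => 'd f (H s *m val x) (H s *m z)) Bx) _.
  rewrite mulmx_sumr linear_sum; apply: eq_bigr => ij _.
  by rewrite -scalemxAr linearZ.
(* The equation H' = - H A enters here: its sign makes the test function evolve against the
   transport. *)
- move=> s x.
  have := is_derive_test_curve cf (dH s) (unitmx_neq0 (uH s) (sphere_neq0 x)).
  by move=> D; apply: (is_derive_ext D) => //; rewrite mulNmx -mulmxA linearN.
- move=> s r r0; rewrite (max_l r0) maxxx.
  have := rho_weak _ (test_C1_sphere cf hf (uH s)) r r0.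
  rewrite (same_measure_Rintegral _ rho_0) => ->.
  apply: eq_Rintegral => q; rewrite inE/= in_itv/= => /andP[q0 _].
  by rewrite max_l//; apply: eq_Rintegral => x _; exact: test_drift.
Qed.

(** * Inverse maps and the pushforward representation *)

Lemma PhiK (R : realType) (n : nat) (G H : 'M[R]_n.+1) (x : sphere R n) :
  G *m H = 1%:M -> Phi G (Phi H x) = x.
Proof.
move=> GH; have [_ uH] := mulmx1_unit GH.
have Hx0 := unitmx_neq0 uH (sphere_neq0 x).
apply: val_inj; rewrite /Phi.
have c0 : 0 < (enorm (H *m val x))^-1 by rewrite invr_gt0 enorm_gt0.
have -> : G *m val (normalize (H *m val x)) = (enorm (H *m val x))^-1 *: val x.
  by rewrite val_normalize// -scalemxAr mulmxA GH mul1mx.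
rewrite val_normalize ?scaler_eq0 ?negb_or ?gt_eqF ?sphere_neq0//.
by rewrite enormZ (sphere_val x) mulr1 gtr0_norm// scalerA mulVf ?scale1r// gt_eqF.
Qed.

(** For f defining a cone set, the powers of g = 1 / (1 + f) are again admissible, so all moments of
    g agree. They determine the mass of g = 1, the complement of the cone set. By 0-homogeneity f
    does not see the normalisation in [Phi]. *)
Lemma pushPhi_inverse (R : realType) (n : nat) (H : 'M[R]_n.+1)
    (mu nu : probability (sphere R n) R) :
  H \in unitmx ->
  (forall f : 'cV[R]_n.+1 -> R, C1_off0 f -> (forall a v, 0 < a -> f (a *: v) = f v) ->
    \int[mu]_x f (H *m val x) = \int[nu]_x f (val x)) ->
  same_measure (pushPhi H mu) nu.
Proof.
move=> uH munu; apply: cone_sets_unique => _ [f [cf hf f0 ->]].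
pose g v := (1 + f v)^-1.
have f1 v : 0 < 1 + f v by rewrite ltr_pwDl.
have cg : C1_off0 g.
  apply: (@C1_off0V _ _ (fun v => 1 + f v)) => [|v _]; last by rewrite gt_eqF.
  exact: (C1_off0D (C1_off0_cst 1) cf).
have cgk k : C1_off0 (fun v => g v ^+ k).
  elim: k => [|k IH]; first exact: C1_off0_cst.
  have := C1_off0M cg IH; congr C1_off0; apply/funext => v; exact: esym (exprS _ _).
have g01 v : 0 <= g v <= 1.
  by rewrite invr_ge0 ltW// invf_le1// lerDl f0.
have g1 v : g v = 1 <-> ~ (0 < f v).
  split=> [e|/negP]; last first.
    rewrite -leNgt => fv; have fv0 : f v = 0 by apply/eqP; rewrite eq_le fv f0.
    by rewrite /g fv0 addr0 invr1.
  have : 1 + f v = 1 by rewrite -[LHS]invrK -/(g v) e invr1.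
  by move=> h; apply/negP; rewrite -leNgt -(lerD2l 1) h addr0.
have mf B : B \in unitmx -> measurable_fun setT (fun x : sphere R n => f (B *m val x)).
  by move=> uB; apply: sphere_continuous_measurable; exact: C1_off0_sphere_continuous.
have mg B : B \in unitmx -> measurable_fun setT (fun x : sphere R n => g (B *m val x)).
  by move=> uB; apply: sphere_continuous_measurable; exact: C1_off0_sphere_continuous.
have mg1 : measurable_fun setT (fun x : sphere R n => g (val x)).
  by have := mg _ (unitmx1 R n.+1); under eq_fun do rewrite mul1mx.
have E := prob_eq_moments (P := mu) (Q := nu) (mg _ uH) (fun x => g01 _)
  mg1 (fun x => g01 _) (fun k => munu _ (cgk k)
    (fun a v a0 => congr1 (fun z => (1 + z)^-1 ^+ k) (hf a v a0))).
have mS B : B \in unitmx -> measurable [set x : sphere R n | 0 < f (B *m val x)].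
  move=> uB; apply: open_measurable_sphere.
  apply: (@open_comp _ _ (fun x : sphere R n => f (B *m val x)) [set y | 0 < y]); last first.
    exact: open_gt.
  by move=> x _; exact: C1_off0_sphere_continuous.
have mS1 : measurable [set x : sphere R n | 0 < f (val x)].
  have := mS _ (unitmx1 R n.+1); congr measurable.
  by apply/seteqP; split => x /=; rewrite mul1mx.
have pre : pushPhi H mu [set x : sphere R n | 0 < f (val x)] =
    mu [set x | 0 < f (H *m val x)].
  rewrite /pushPhi/= /distribution/= /pushforward; congr (mu _).
  have Phif (x : sphere R n) : f (val (Phi H x)) = f (H *m val x).
    have Hx0 := unitmx_neq0 uH (sphere_neq0 x).
    by rewrite /Phi val_normalize// hf// invr_gt0 enorm_gt0.
  by apply/seteqP; split => x /=; rewrite Phif.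
rewrite pre.
have c1 : [set x : sphere R n | g (H *m val x) = 1] = ~` [set x | 0 < f (H *m val x)].
  by apply/seteqP; split => x /= /g1.
have c2 : [set x : sphere R n | g (val x) = 1] = ~` [set x | 0 < f (val x)].
  by apply/seteqP; split => x /= /g1.
have := E; rewrite c1 c2 !probability_setC//; last exact: mS.
have fin1 : mu [set x | 0 < f (H *m val x)] \is a fin_num.
  by apply: fin_num_measure; exact: mS.
have fin2 : nu [set x | 0 < f (val x)] \is a fin_num by exact: fin_num_measure.
rewrite -(fineK fin1) -(fineK fin2) -!EFinB => -[] /eqP.
by rewrite (inj_eq (addrI _)) eqr_opp => /eqP ->.
Qed.

Unset Implicit Arguments.
Set Strict Implicit.

Theorem theorem3p1 (R : realType) (n : nat)
    (F : probability (sphere R n) R -> 'M[R]_n.+1)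
    (F_lipschitz : exists2 L : R, 0 <= L &
      forall mu nu, ((opnorm (F mu - F nu))%:E <= L%:E * W1 mu nu)%E)
    (F_trace0 : forall mu, \tr (F mu) = 0)
    (rho0 : probability (sphere R n) R)
    (rho : R -> probability (sphere R n) R)
    (rho_sol : weak_solution F rho0 rho) :
  exists G : R -> 'M[R]_n.+1,
    [/\ forall t, 0 <= t -> SLpm R n (G t),
        G 0 = 1%:M,
        forall t, 0 <= t ->
          has_derivative_on_nneg G t (F (pushPhi (G t) rho0) *m G t) &
        forall t, 0 <= t -> same_measure (rho t) (pushPhi (G t) rho0)].
Proof.
have [L L0 FL] := F_lipschitz; have [rho_cont rho_0 rho_weak] := rho_sol.
pose A s := F (rho (Num.max s 0)).
have cA : continuous A.
  by move=> s; apply: (lipschitz_cvg L0 FL); exact: W1_continuous_max.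
have [G [H [G0 dG dH HG detG]]] := linear_flow cA (fun s => F_trace0 _).
have uH s : H s \in unitmx by have [] := mulmx1_unit (HG s).
have H0 : H 0 = 1%:M by have := HG 0; rewrite G0 mulmx1.
have rhoE t : 0 <= t -> same_measure (rho t) (pushPhi (G t) rho0).
  move=> t0 B mB.
  have mGB : measurable (Phi (G t) @^-1` B).
    by have := measurable_Phi (G t) measurableT mB; rewrite setTI.
  have push : same_measure (pushPhi (H t) (rho t)) rho0.
    apply: (pushPhi_inverse (uH t)) => f cf hf.
    exact: (weak_solution_conserved rho_sol cA H0 uH dH cf hf t0).
  (* The identity is evaluated on the preimage of [B] under [Phi (G t)]; pulled back once more by
     [Phi (H t)], this set is [B] again. *)
  have := push _ mGB; rewrite /pushPhi/= /distribution/= /pushforward => <-.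
  by congr (rho t _); apply/seteqP; split => x /=; rewrite PhiK//; exact: mulmx1C.
exists G; split => // t t0.
  by rewrite /SLpm/= detG normr1.
rewrite -(lipschitz_same L0 FL (rhoE t t0)).
(* The flow is differentiable on both sides; restricting the limit to t + h >= 0 gives the
   derivative on the half-line. *)
have := (is_derive_cvg G t _).2 (dG t); rewrite /A max_l// => dGt.
rewrite /has_derivative_on_nneg.
under eq_fun => h do rewrite [t + h]addrC.
exact: cvg_within_filter dGt.
Qed.
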